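(* Let $n \ge 2$ and let $\mathbf{v}=(v_1,\dots,v_n) \in (S^1)^n$. Let $\mathbf{v}^\perp=\{\mathbf{x}\in \Phi^n : 0 \in v_1x_1 \boxplus \cdots \boxplus v_nx_n\}$ (the set of covectors of a loopless rank $n-1$ tropical phased matroid on $[n]$). Then the topological order complex $\Delta(\mathbf{v}^\perp-\{\mathbf{0}\})$ is homeomorphic to the sphere $S^{2n-3}$.
   Context: The tropical phase hyperfield $\Phi$ is the set $S^1\cup\{0\}\subset\mathbb{C}$ with complex multiplication and the multivalued addition $\boxplus$ given by: $x\boxplus 0=\{x\}$; $x\boxplus(-x)=S^1\cup\{0\}$ for $x\neq 0$; and, for $x,y\in S^1$ with $y\neq -x$, $x\boxplus y$ is the smallest closed arc of $S^1$ joining $x$ and $y$ (so $x\boxplus x=\{x\}$). Iterated sums are defined by $x_1\boxplus\cdots\boxplus x_n=\bigcup\{w\boxplus x_n : w\in x_1\boxplus\cdots\boxplus x_{n-1}\}$. $\Phi$ carries the subspace topology from $\mathbb{C}$ and the partial order whose only nontrivial relations are $0<x$ for $x\in S^1$; $\Phi^n$ carries the product topology and the componentwise order, and $\mathbf{v}^\perp-\{\mathbf{0}\}$ the induced subspace topology and order. A topological poset is a Hausdorff space $\mathcal{P}$ with a partial order $\le$ such that $\{(x,y):x\le y\}$ is closed in $\mathcal{P}^2$. Its topological order complex $\Delta(\mathcal{P})$ is the geometric realization $\bigl(\bigsqcup_{k\ge 0} N_k(\mathcal{P})\times\Delta^k\bigr)/\!\sim$ of the simplicial space with $N_k(\mathcal{P})=\{(x_0,\dots,x_k)\in\mathcal{P}^{k+1}: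 x_0\le x_1\le\cdots\le x_k\}$ (subspace topology), face maps deleting an entry and degeneracy maps repeating an entry. *)

(* Defs.v *)
From HB Require Import structures.
From mathcomp Require Import all_boot all_order all_algebra complex zify.
From mathcomp Require Import all_classical all_reals all_analysis.
From Stdlib Require Import Relation_Operators.

Set Implicit Arguments.
Unset Strict Implicit.
Unset Printing Implicit Defensive.

Import Order.TTheory GRing.Theory Num.Theory numFieldNormedType.Exports.
(* [I -> T] carries the product topology *)
Import ArrowAsProduct.

Local Open Scope classical_set_scope.
Local Open Scope complex_scope.
Local Open Scope ring_scope.

Definition homeomorphic (T U : topologicalType) : Prop :=
  exists f : T -> U, exists g : U -> T,
    [/\ continuous f, continuous g, cancel f g & cancel g f].

Definition sphere (R : realType) (d : nat) : set 'rV[R]_d.+1 :=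
  [set x | \sum_i x ord0 i ^+ 2 = 1].
Arguments sphere R d _ : clear implicits.

HB.mixin Record isTopPoset d (T : Type) & POrderedTopological d T := {
  topposet_hausdorff : hausdorff_space T;
  topposet_closed_le : closed [set xy : T * T | (xy.1 <= xy.2)%O]
}.

#[short(type="topPosetType")]
HB.structure Definition TopPoset d :=
  { T of POrderedTopological d T & isTopPoset d T }.

Lemma continuous_pairmap (T U : topologicalType) (f : T -> U) :
  continuous f -> continuous (fun xy : T * T => (f xy.1, f xy.2)).
Proof.
move=> cf [x y]; apply: cvg_pair => /=.
- by apply: (@cvg_comp _ _ _ fst f); [exact: cvg_fst|exact: cf].
- by apply: (@cvg_comp _ _ _ snd f); [exact: cvg_snd|exact: cf].
Qed.

Lemma set_type_hausdorff (T : topologicalType) (A : set T) :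
  hausdorff_space T -> hausdorff_space (set_type A).
Proof.
move=> hT x y xy; apply: val_inj; apply: hT => U V Ux Vy.
have cv : continuous (set_val : A -> T) by exact: initial_continuous.
have [z [zU zV]] := xy _ _ (cv x U Ux) (cv y V Vy).
by exists (set_val z).
Qed.

Section Power.
Context (I : eqType) d (T : topPosetType d).

Lemma power_hausdorff : hausdorff_space (I -> T).
Proof. by apply: hausdorff_product => _; exact: topposet_hausdorff. Qed.

Lemma power_closed_le : closed [set xy : (I -> T) * (I -> T) | (xy.1 <= xy.2)%O].
Proof.
rewrite (_ : mkset _ = \bigcap_(i in [set: I])
    ((fun xy : (I -> T) * (I -> T) => (xy.1 i, xy.2 i)) @^-1`
      [set ab : T * T | (ab.1 <= ab.2)%O])).
  apply: closed_bigI => i _.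
  have /continuous_closedP : continuous
      (fun xy : (I -> T) * (I -> T) => (xy.1 i, xy.2 i)).
    apply: (@continuous_pairmap (I -> T) T (fun f => f i)).
    exact: (@proj_continuous _ (fun _ => T) i).
  by apply; exact: topposet_closed_le.
apply/seteqP; split => -[f g] /= fg; first by move=> i _; exact: (lefP f g fg).
by apply/(lefP f g) => i; exact: fg.
Qed.

HB.instance Definition _ :=
  isTopPoset.Build _ (I -> T) power_hausdorff power_closed_le.

End Power.

Section Subset.
Context d (T : topPosetType d) (A : set T).

HB.instance Definition _ := SubChoice.copy (set_type A) {x : T | x \in A}.
HB.instance Definition _ := [SubChoice_isSubPOrder of set_type A by <: with d].

Lemma subset_closed_le :
  closed [set xy : set_type A * set_type A | (xy.1 <= xy.2)%O].
Proof.
have cv : continuous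
    (fun xy : set_type A * set_type A => (set_val xy.1, set_val xy.2) : T * T).
  by apply: continuous_pairmap; exact: initial_continuous.
have := (iffLR (continuous_closedP _)) cv _ (@topposet_closed_le d T).
by [].
Qed.

HB.instance Definition _ := isTopPoset.Build d (set_type A)
  (set_type_hausdorff (@topposet_hausdorff d T)) subset_closed_le.

End Subset.

Definition simplex (R : realType) (k : nat) : set 'rV[R]_k.+1 :=
  [set t | (forall i, 0 <= t ord0 i) /\ \sum_i t ord0 i = 1].

Definition chain d (P : topPosetType d) (k : nat) : set ('I_k.+1 -> P) :=
  [set x | forall i j : 'I_k.+1, (i <= j)%N -> (x i <= x j)%O].

Arguments simplex R k _ : clear implicits.
Arguments chain {d} P k _.

(* The monotone surjection [0, k+1] -> [0, k] taking the value i twice; the *)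
(* monotone injection [0, k] -> [0, k+1] omitting i is [lift i]. *)
Definition merge_ord (k : nat) (i : 'I_k.+1) (j : 'I_k.+2) : 'I_k.+1 :=
  inord (unbump i j).

Lemma merge_ordE k (i : 'I_k.+1) (j : 'I_k.+2) :
  merge_ord i j = unbump i j :> nat.
Proof.
rewrite /merge_ord inordK // /unbump.
by have := ltn_ord i; have := ltn_ord j; case: ltnP; lia.
Qed.

Lemma lift_mono k (i : 'I_k.+2) (a b : 'I_k.+1) :
  (a <= b)%N -> (lift i a <= lift i b)%N.
Proof. by move=> ab; rewrite /= leq_bump2. Qed.

Lemma merge_ord_mono k (i : 'I_k.+1) (a b : 'I_k.+2) :
  (a <= b)%N -> (merge_ord i a <= merge_ord i b)%N.
Proof.
by move=> ab; rewrite !merge_ordE /unbump; case: ltnP; case: ltnP; lia.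
Qed.

Section OrderComplex.
Context (R : realType) d (P : topPosetType d).

Section Operators.
Context (m k : nat) (f : 'I_m.+1 -> 'I_k.+1).

Lemma reindex_chain_subproof
    (fm : forall a b : 'I_m.+1, (a <= b)%N -> (f a <= f b)%N)
    (x : chain P k) :
  set_val x \o f \in chain P m.
Proof. by apply/mem_set => a b ab /=; apply: (set_valP x); exact: fm. Qed.

Definition reindex_chain fm (x : chain P k) : chain P m :=
  exist _ (set_val x \o f) (reindex_chain_subproof fm x).

(* The affine map sending vertex a of the m-simplex to vertex f a. *)
Definition push_row (t : 'rV[R]_m.+1) : 'rV[R]_k.+1 :=
  \row_b \sum_(a | f a == b) t ord0 a.

Lemma push_simplex_subproof (t : simplex R m) :
  push_row (set_val t) \in simplex R k.
Proof.
have [t0 t1] := set_valP t; apply/mem_set; split.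
  by move=> b; rewrite mxE sumr_ge0.
under eq_bigr do rewrite mxE.
by rewrite -t1 (partition_big f predT).
Qed.

Definition push_simplex (t : simplex R m) : simplex R k :=
  exist _ (push_row (set_val t)) (push_simplex_subproof t).

End Operators.

Definition face k (i : 'I_k.+2) : chain P k.+1 -> chain P k :=
  reindex_chain (lift_mono i).
Definition degeneracy k (i : 'I_k.+1) : chain P k -> chain P k.+1 :=
  reindex_chain (merge_ord_mono i).
Definition coface k (i : 'I_k.+2) : simplex R k -> simplex R k.+1 :=
  push_simplex (lift i).
Definition codegeneracy k (i : 'I_k.+1) : simplex R k.+1 -> simplex R k :=
  push_simplex (merge_ord i).

Definition cells : Type := {k : nat & (chain P k * simplex R k)%type}.
HB.instance Definition _ := Topological.on cells.

Definition cell k (x : chain P k) (t : simplex R k) : cells :=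
  existT (fun k => (chain P k * simplex R k)%type) k (x, t).

Inductive gluing : cells -> cells -> Prop :=
| gluing_face k (i : 'I_k.+2) (x : chain P k.+1) (t : simplex R k) :
    gluing (cell (face i x) t) (cell x (coface i t))
| gluing_degeneracy k (i : 'I_k.+1) (x : chain P k) (t : simplex R k.+1) :
    gluing (cell (degeneracy i x) t) (cell x (codegeneracy i t)).

Definition glued (a b : cells) : bool := `[< clos_refl_sym_trans _ gluing a b >].

Lemma glued_refl : reflexive glued.
Proof. by move=> a; apply/asboolP; exact: rst_refl. Qed.

Lemma glued_sym : symmetric glued.
Proof. by move=> a b; apply/asboolP/asboolP; exact: rst_sym. Qed.

Lemma glued_trans : transitive glued.
Proof.
by move=> b a c /asboolP ab /asboolP bc; apply/asboolP; exact: rst_trans ab bc.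
Qed.

Definition glued_equiv := EquivRel glued glued_refl glued_sym glued_trans.

Definition order_complex : Type := {eq_quot glued_equiv}%qT.
HB.instance Definition _ := Quotient.on order_complex.
HB.instance Definition _ :=
  Topological.copy order_complex (quotient_topology order_complex).

End OrderComplex.

Section Phase.
Context (R : realType).

(* [(R[i])^o] is the complex field as a normed space over itself, which is how *)
(* it gets its topology; its norm takes values in [R[i]]. *)
Definition circle : set (R[i])^o := [set z | `|z| = 1].

Definition phase : Type := set_type (circle `|` [set 0]).
HB.instance Definition _ := Topological.on phase.
HB.instance Definition _ := SubChoice.on phase.

Definition phase_val (x : phase) : R[i] := \val x.

Implicit Types x y z : phase.

Definition phase_le x y : bool := (phase_val x == 0) || (x == y).

Lemma phase_le_refl : reflexive phase_le.
Proof. by move=> x; rewrite /phase_le eqxx orbT. Qed.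

Lemma phase_le_anti : antisymmetric phase_le.
Proof.
move=> x y /andP[/orP[/eqP x0|/eqP //] /orP[/eqP y0|/eqP //]].
by apply: val_inj; exact: etrans x0 (esym y0).
Qed.

Lemma phase_le_trans : transitive phase_le.
Proof.
move=> y x z; rewrite /phase_le => /orP[-> //|/eqP <-].
by [].
Qed.

HB.instance Definition _ := Order.Le_isPOrder.Build Order.default_display phase
  phase_le_refl phase_le_anti phase_le_trans.

Lemma phase_hausdorff : hausdorff_space phase.
Proof. apply: set_type_hausdorff; exact: norm_hausdorff. Qed.

Lemma phase0_subproof : (0 : (R[i])^o) \in circle `|` [set 0].
Proof. by apply/mem_set; right. Qed.
Definition phase0 : phase := exist _ 0 phase0_subproof.

Lemma phase_closed_le : closed [set xy : phase * phase | (xy.1 <= xy.2)%O].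
Proof.
rewrite (_ : mkset _ = (fst @^-1` [set phase0]) `|`
    [set xy : phase * phase | xy.1 = xy.2]).
  apply: closedU.
    have cf : continuous (fst : phase * phase -> phase) by move=> xy; exact: cvg_fst.
    apply: ((iffLR (continuous_closedP _)) cf).
    exact: (accessible_closed_set1 (hausdorff_accessible phase_hausdorff)).
  move=> [x y] clxy /=; apply: phase_hausdorff => U V Ux Vy.
  have [|[a b] /= [-> [Ub Vb]]] := clxy (U `*` V); first by exists (U, V).
  by exists b.
apply/seteqP; split => -[x y] /=.
  by case/orP => /eqP; [left; exact: val_inj | right].
by case => [->|->]; [apply/orP; left; apply/eqP | exact: lexx].
Qed.

HB.instance Definition _ :=
  isTopPoset.Build _ phase phase_hausdorff phase_closed_le.

Lemma phase_mul_subproof x y :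
  (\val x * \val y : (R[i])^o) \in circle `|` [set 0].
Proof.
apply/mem_set; case: (set_valP x) => /= [x1|->]; last by right; rewrite mul0r.
case: (set_valP y) => /= [y1|->]; last by right; rewrite mulr0.
by left; rewrite /circle/= normrM x1 y1 mulr1.
Qed.
Definition phase_mul x y : phase :=
  exist _ (\val x * \val y : (R[i])^o) (phase_mul_subproof x y).

Definition cis (t : R) : R[i] := cos t +i* sin t.

(* The closed arcs of the circle are the images of the segments [a, b] under *)
(* [cis]; [b - a] is the length of the arc when it is at most 2 * pi. *)
Definition arc (a b : R) : set phase :=
  [set z | exists2 t, a <= t <= b & phase_val z = cis t].

Definition arc_joins x y (a b : R) : Prop :=
  a <= b /\ ((cis a = phase_val x /\ cis b = phase_val y) \/
             (cis a = phase_val y /\ cis b = phase_val x)).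

Definition smallest_arc x y : set phase :=
  [set z | exists a b, [/\ arc_joins x y a b,
    (forall a' b', arc_joins x y a' b' -> b - a <= b' - a') & arc a b z]].

Definition phase_add x y : set phase :=
  if x == phase0 then [set y]
  else if y == phase0 then [set x]
  else if phase_val y == - phase_val x then setT
  else smallest_arc x y.

Definition phase_sum (s : seq phase) : set phase :=
  if s is x :: s' then
    foldl (fun (A : set phase) y => \bigcup_(w in A) phase_add w y) [set x] s'
  else [set phase0].

Definition perp n (v : 'I_n -> phase) : set ('I_n -> phase) :=
  [set x | phase_sum [seq phase_mul (v i) (x i) | i <- enum 'I_n] phase0].

End Phase.

(* Main.v *)
(* Replacing a weighted chain x_0 < ... < x_k by the point z = sum_j t_j (v x_j)
   of C^n is injective on the order complex: the weights are recovered from the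
   distinct nonzero moduli |z_i|, which are the tails t_j + ... + t_k, and x_j
   from the phases of the entries with |z_i| >= t_j + ... + t_k.  Since 0 lies
   in a phase sum of nonzero phases iff these lie in no open half-plane, the
   image consists of the z with max |z_i| = 1 whose entries of modulus 1 lie in
   no open half-plane, that is, of the z whose smallest enclosing circle is the
   unit circle centered at 0.  As every nonconstant tuple has a unique smallest
   enclosing circle, this image meets each class of nonconstant tuples modulo
   translations and positive scalings exactly once, and the classes form the
   unit sphere of C^n / C(1,...,1).  The resulting bijection is continuous on a
   compact space, because chains with at most n elements suffice. *)
Require Import Defs.
From mathcomp Require Import all_boot all_order all_algebra complex.
From mathcomp Require Import all_classical all_reals all_analysis.
From mathcomp Require Import lra ring zify.
From Stdlib Require Import Relation_Operators.

Set Implicit Arguments.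
Unset Strict Implicit.
Unset Printing Implicit Defensive.

Import Order.TTheory GRing.Theory Num.Theory numFieldNormedType.Exports.
Import ArrowAsProduct.
Local Open Scope classical_set_scope.
Local Open Scope complex_scope.
Local Open Scope ring_scope.

Local Notation Re := complex.Re.
Local Notation Im := complex.Im.

(** * Topological preliminaries *)

(** The sum is a left fold of set-valued operations, so whether it contains 0 is decided by an
    invariant: a partial sum is {0}, is everything, or contains the whole arc between the extreme
    directions of the terms so far. Containment is enough, since the opposite bound comes from
    half-planes: an open half-plane has no antipodal pair and is therefore stable under sums. Arcs
    are treated as plane cones, where signs of determinants replace comparisons of angles. The
    half-plane condition always takes the form: for all [a] and [b], some entry of modulus 1
    satisfies [a * x + b * y <= 0]. For fixed [a] and [b] it is closed, and the pair (0, 0) makes it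
    assert that such an entry exists. With (a, b) read as a displacement of the center, it is also
    the first-order condition for a smallest enclosing circle, which is why one condition describes
    both covectors and circles. Continuity of the inverse map is never checked by hand: it would
    have to be followed through cells whose dimension drops when moduli merge or vanish. *)

Lemma set_val_continuous (T : topologicalType) (A : set T) :
  continuous (set_val : A -> T).
Proof. exact: initial_continuous. Qed.

Lemma compact_set_type (T : topologicalType) (A : set T) :
  compact A -> compact [set: A].
Proof.
move=> cA F FF _.
have [|p [Ap Fp]] := cA (set_val @ F) _.
  rewrite /fmap /=; apply: filterS (@filterT _ F _) => x _ /=; exact: set_valP.
exists (exist _ p (mem_set Ap)); split => //.
move=> B C FB; rewrite nbhsE => -[D [oD Dp] DC].
have [E oE ED] := oD.
have FB' : (set_val @ F) (image B (set_val : A -> T)).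
  change (F ((set_val : A -> T) @^-1` (image B set_val))).
  by apply: filterS FB => x Bx; exists x.
have Ep : nbhs p E.
  apply: open_nbhs_nbhs; split => //.
  by move: Dp; rewrite -ED.
have [_ [[x Bx <-] Ex]] := Fp _ _ FB' Ep.
by exists x; split => //; apply: DC; rewrite -ED.
Qed.

Lemma compact_bij_homeomorphic (T U : topologicalType) (f : T -> U) :
  compact [set: T] -> hausdorff_space U -> continuous f ->
  injective f -> (forall u, exists t, f t = u) -> homeomorphic T U.
Proof.
move=> cT hU cf fi fs.
have [g gK] := choice fs.
exists f, g; split => //; last by move=> t; apply: fi; rewrite gK.
apply/continuous_closedP => A cA.
have -> : g @^-1` A = f @` A.
  apply/seteqP; split => [u /= Agu|_ [t At <-] /=]; first by exists (g u).
  by rewrite (_ : g (f t) = t) //; apply: fi; rewrite gK.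
apply: compact_closed => //; apply: continuous_compact.
  exact: continuous_subspaceT.
exact: subclosed_compact cA cT _.
Qed.

(** * Real coordinates on the complex field *)

Section ComplexTopology.
Context (R : realType).

Lemma Re_continuous : continuous (fun z : (R[i])^o => Re z).
Proof.
move=> z U /nbhs_ballP[e e0 eU].
exists e%:C; first by rewrite /= ltcR.
move=> w /= zw; apply: eU; move: zw; rewrite /ball /=.
apply: contraTT; rewrite -leNgt => h.
rewrite le_gtF //.
apply: le_trans (normc_ge_Re _); rewrite lecR; apply: le_trans h _.
by case: (z) (w) => [a b] [c d].
Qed.

Lemma normc_ge_Im (z : R[i]) : `|Im z|%:C <= `|z|.
Proof.
have := normc_ge_Re (z * 'i); rewrite ReiNIm normrN normrM.
by rewrite [`|'i|]normc_def /= expr0n expr1n add0r sqrtr1 mulr1.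
Qed.

Lemma Im_continuous : continuous (fun z : (R[i])^o => Im z).
Proof.
move=> z U /nbhs_ballP[e e0 eU].
exists e%:C; first by rewrite /= ltcR.
move=> w /= zw; apply: eU; move: zw; rewrite /ball /=.
apply: contraTT; rewrite -leNgt => h.
rewrite le_gtF //.
apply: le_trans (normc_ge_Im _); rewrite lecR; apply: le_trans h _.
by case: (z) (w) => [a b] [c d].
Qed.

Lemma Complex_continuous :
  continuous (fun p : R * R => (p.1 +i* p.2 : (R[i])^o)).
Proof.
(* Radii of balls are elements of [R[i]]; a positive one has imaginary part 0. *)
move=> p U [[e e'] /= + eU]; rewrite ltcE /= => /andP[/eqP ee e0].
rewrite {}ee {e'} in eU.
have e20 : 0 < e / 2 by rewrite divr_gt0.
change (\forall q \near p, U (q.1 +i* q.2)).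
near=> q; apply: eU => /=.
have h1 : `|p.1 - q.1| < e / 2.
  near: q; apply: cvgr_dist_lt => //; exact: cvg_fst.
have h2 : `|p.2 - q.2| < e / 2.
  near: q; apply: cvgr_dist_lt => //; exact: cvg_snd.
have -> : (p.1 +i* p.2 : (R[i])^o) - (q.1 +i* q.2 : (R[i])^o) =
          (p.1 - q.1)%:C + (p.2 - q.2)%:C * 'i.
  by simpc.
apply: le_lt_trans (ler_normD _ _) _.
rewrite normrM !normc_def /= expr0n /= !addr0 !add0r expr1n !sqrtr_sqr sqrtr1.
rewrite -!rmorphM -rmorphD /= mulr1 ltcR; lra.
Unshelve. all: by end_near. Qed.

End ComplexTopology.

(** * Phases and their sums *)

Section Phase.
Context (R : realType).
Implicit Types (x y z w : phase R) (s : seq (phase R)) (A : set (phase R)).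

(** Real coordinates, because [R[i]] is only partially ordered while the sign conditions below are
    real inequalities. *)
Definition px x : R := Re (phase_val x).
Definition py x : R := Im (phase_val x).

Lemma px0 : px (phase0 R) = 0. Proof. by []. Qed.
Lemma py0 : py (phase0 R) = 0. Proof. by []. Qed.

Lemma phaseP x y : px x = px y -> py x = py y -> x = y.
Proof.
rewrite /px /py => h1 h2; apply: val_inj.
change (phase_val x = phase_val y).
by move: h1 h2; case: (phase_val x) (phase_val y) => [a b] [c d] /= -> ->.
Qed.

Lemma phase_val_eq0 x : (phase_val x == 0) = (x == phase0 R).
Proof.
apply/eqP/eqP => [h|-> //]; apply: phaseP; by rewrite /px /py h.
Qed.

Lemma circleE (z : (R[i])^o) : circle z <-> Re z ^+ 2 + Im z ^+ 2 = 1.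
Proof.
rewrite /circle /= normc_def; split => [[h]|->]; last by rewrite sqrtr1.
by apply/eqP; rewrite -(@eqr_sqrt _ _ 1) ?addr_ge0 ?sqr_ge0 ?ler01 // h sqrtr1.
Qed.

Lemma phase_unit x : x != phase0 R -> px x ^+ 2 + py x ^+ 2 = 1.
Proof.
rewrite -phase_val_eq0 => x0; apply/circleE.
by case: (set_valP x) => // h; move: x0; rewrite /phase_val [\val x]h eqxx.
Qed.

Lemma unit_phase_neq0 x : px x ^+ 2 + py x ^+ 2 = 1 -> x != phase0 R.
Proof.
apply: contraPneq => ->; rewrite px0 py0 expr0n addr0 => /esym/eqP.
by rewrite oner_eq0.
Qed.

Lemma exists_phase (a b : R) : a ^+ 2 + b ^+ 2 = 1 ->
  exists2 x, px x = a & py x = b.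
Proof.
move=> ab.
have h : (a +i* b : (R[i])^o) \in @circle R `|` [set 0].
  by apply/mem_set; left; apply/circleE.
by exists (exist _ (a +i* b : (R[i])^o) h : phase R).
Qed.

Lemma px_continuous : continuous px.
Proof.
move=> x; apply: (@continuous_comp _ _ _ (fun x : phase R => phase_val x : (R[i])^o)).
  exact: (@set_val_continuous _ _ x).
exact: Re_continuous.
Qed.

Lemma py_continuous : continuous py.
Proof.
move=> x; apply: (@continuous_comp _ _ _ (fun x : phase R => phase_val x : (R[i])^o)).
  exact: (@set_val_continuous _ _ x).
exact: Im_continuous.
Qed.

Lemma compact_phase : compact [set: phase R].
Proof.
apply: compact_set_type; apply: compactU; last exact: compact_set1.
pose A := [set p : R * R | p.1 ^+ 2 + p.2 ^+ 2 = 1].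
have -> : @circle R = (fun p : R * R => (p.1 +i* p.2 : (R[i])^o)) @` A.
  apply/seteqP; split => [z /circleE h|_ [p pA <-]]; last exact/circleE.
  by exists (Re z, Im z) => //; case: (z).
apply: continuous_compact.
  exact/continuous_subspaceT/Complex_continuous.
apply: (@subclosed_compact (R * R)%type A (`[(-1 : R), 1] `*` `[(-1 : R), 1])).
- pose f (p : R * R) : R := p.1 ^+ 2 + p.2 ^+ 2.
  have -> : A = f @^-1` [set 1] by [].
  have cf : continuous f.
    move=> p; apply: cvgD; apply: (@continuous_comp _ _ _ _ (fun t : R => t ^+ 2)).
    + exact: cvg_fst.
    + exact: exprn_continuous.
    + exact: cvg_snd.
    + exact: exprn_continuous.
  by apply: ((iffLR (continuous_closedP _)) cf); exact: closed_eq.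
- by apply: compact_setX; exact: segment_compact.
- move=> [a b]; rewrite /A /= => ab; rewrite !in_itv /=.
  by split; apply/andP; split; nra.
Qed.

Lemma px_mul x y : px (phase_mul x y) = px x * px y - py x * py y.
Proof.
by rewrite /px /py /phase_mul /phase_val /=; case: (\val x) (\val y) => [a b] [c d].
Qed.

Lemma py_mul x y : py (phase_mul x y) = px x * py y + py x * px y.
Proof.
by rewrite /px /py /phase_mul /phase_val /=; case: (\val x) (\val y) => [a b] [c d].
Qed.

End Phase.

(** * Smallest arcs as plane cones *)

Section PhaseAdd.
Context (R : realType).
Implicit Types (x y z w p q : phase R) (s : seq (phase R)) (A : set (phase R)).

Lemma acos_unit (a b : R) : a ^+ 2 + b ^+ 2 = 1 -> 0 <= b ->
  [/\ 0 <= acos a <= pi, cos (acos a) = a & sin (acos a) = b].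
Proof.
move=> ab b0; have a1 : -1 <= a <= 1 by apply/andP; split; nra.
have [h1 h2] := acos_def a1; split => //.
rewrite sin_acos // (_ : 1 - a ^+ 2 = b ^+ 2); last by lra.
by rewrite sqrtr_sqr ger0_norm.
Qed.

Lemma exists_angle (a b : R) : a ^+ 2 + b ^+ 2 = 1 ->
  exists t, cos t = a /\ sin t = b.
Proof.
move=> ab; have [b0|b0] := leP 0 b.
  by have [_ h1 h2] := acos_unit ab b0; exists (acos a).
have [||_ h1 h2] := @acos_unit a (- b); [by rewrite sqrrN|by rewrite oppr_ge0 ltW|].
by exists (- acos a); rewrite cosN sinN h1 h2 opprK.
Qed.

Definition antipodal x y := phase_val y = - phase_val x.

Lemma antipodalP x y : antipodal x y <-> px y = - px x /\ py y = - py x.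
Proof.
rewrite /antipodal /px /py; case: (phase_val x) (phase_val y) => [a b] [c d].
by split => [[-> ->]|/= [-> ->]].
Qed.

Lemma cis_phase (t : R) x : cis t = phase_val x <-> cos t = px x /\ sin t = py x.
Proof.
by rewrite /px /py /cis; case: (phase_val x) => a b; split => [[-> ->]|/= [-> ->]].
Qed.

(** The angle between two unit vectors, from their inner product. *)
Definition join_length x y : R := acos (px x * px y + py x * py y).

Section TwoPhases.
Context x y (x0 : x != phase0 R) (y0 : y != phase0 R) (xy : ~ antipodal x y).
(** Cosine and sine of the oriented angle from [x] to [y]. The sign of [s] decides which of the two
    starts a shortest arc. *)
Let c := px x * px y + py x * py y.
Let s := px x * py y - py x * px y.

Let cs1 : c ^+ 2 + s ^+ 2 = 1.
Proof.
transitivity ((px x ^+ 2 + py x ^+ 2) * (px y ^+ 2 + py y ^+ 2)).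
  by rewrite /c /s; ring.
by rewrite !phase_unit // mulr1.
Qed.

Let yE : px y = px x * c - py x * s /\ py y = px x * s + py x * c.
Proof.
have h := phase_unit x0; split.
  by rewrite -[LHS]mul1r -h /c /s; ring.
by rewrite -[LHS]mul1r -h /c /s; ring.
Qed.

Let cN1 : c != -1.
Proof.
apply/eqP => cN1; apply: xy; apply/antipodalP.
have s0 : s = 0.
  by apply/eqP; rewrite -sqrf_eq0; move: cs1; rewrite cN1 sqrrN expr1n => h; apply/eqP; lra.
by have [-> ->] := yE; rewrite cN1 s0; split; ring.
Qed.

Lemma join_length_itv : 0 <= join_length x y < pi.
Proof.
have c1 : -1 <= c <= 1 by apply/andP; split; have := cs1; nra.
rewrite /join_length acos_ge0 //= acos_ltpi //.
by move: c1 => /andP[h1 ->]; rewrite andbT lt_neqAle eq_sym cN1.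
Qed.

Lemma cos_join_length : cos (join_length x y) = c.
Proof.
have c1 : -1 <= c <= 1 by apply/andP; split; have := cs1; nra.
by have [] := acos_def c1.
Qed.

(** Every joining arc, in either direction, has [cos (b - a) = c]. As [cos] is injective on [0, pi],
    no arc shorter than [join_length x y] has this cosine. *)
Lemma join_length_min (a b : R) : arc_joins x y a b -> join_length x y <= b - a.
Proof.
move=> [ab] j; have cE : cos (b - a) = c.
  rewrite cosB; case: j => -[/cis_phase[-> ->] /cis_phase[-> ->]] //.
  by rewrite /c; ring.
have /andP[l0 lpi] := join_length_itv.
rewrite leNgt; apply/negP => h.
suff : b - a = join_length x y by move=> e; move: h; rewrite e ltxx.
apply: cos_inj; last by rewrite cE cos_join_length.
  by rewrite in_itv /= subr_ge0 ab (ltW (lt_trans h lpi)).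
by rewrite in_itv /= l0 ltW.
Qed.

Lemma exists_join : exists a, arc_joins x y a (a + join_length x y).
Proof.
have /andP[l0 _] := join_length_itv.
have [s0|s0] := leP 0 s.
  have [a [ca sa]] := exists_angle (phase_unit x0).
  have [_ h1 h2] := acos_unit cs1 s0.
  exists a; split; first by rewrite lerDl.
  left; split; apply/cis_phase => //.
  by rewrite cosD sinD h1 h2 ca sa; have [-> ->] := yE; split; ring.
have [a [ca sa]] := exists_angle (phase_unit y0).
have [||_ h1 h2] := @acos_unit c (- s); [by rewrite sqrrN|by rewrite oppr_ge0 ltW|].
exists a; split; first by rewrite lerDl.
right; split; apply/cis_phase => //.
rewrite cosD sinD h1 h2 ca sa; have [-> ->] := yE.
by split; rewrite -[RHS]mul1r -cs1; ring.
Qed.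

End TwoPhases.

(** For nonzero, non-antipodal [p] and [q], the nonzero phases in this convex cone form the smallest
    arc. After [smallest_arcP] no angles are needed. *)
Definition cone p q z := exists a b : R, [/\ 0 <= a, 0 <= b,
  px z = a * px p + b * px q & py z = a * py p + b * py q].

Lemma cone_sym p q z : cone p q z -> cone q p z.
Proof.
by move=> [a [b [a0 b0 h1 h2]]]; exists b, a; rewrite h1 h2; split => //; rewrite addrC.
Qed.

(** The angle [t] from [x] to [z] can be taken in [0, pi], because its sine [q * sin l] is
    nonnegative. The sine of [t - l] is [- p * sin l], which is not positive, so [t] cannot exceed
    [l]. *)
Lemma cone_arc x y z (a l : R) : 0 <= l < pi ->
  cis a = phase_val x -> cis (a + l) = phase_val y ->
  z != phase0 R -> cone x y z -> Defs.arc a (a + l) z.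
Proof.
move=> /andP[l0 lpi] /cis_phase[xa ya] /cis_phase[xb yb] z0 [p [q [p0 q0 xz yz]]].
have zu := phase_unit z0.
have sl0 : 0 <= sin l by apply: sin_ge0_pi; rewrite l0 ltW.
have cs := cos2Dsin2 l; have cs' := cos2Dsin2 a.
have u : (p + q * cos l) ^+ 2 + (q * sin l) ^+ 2 = 1.
  rewrite -zu xz yz -xa -ya -xb -yb cosD sinD.
  by rewrite -[LHS]mul1r -cs'; ring.
have [/andP[t0 tpi] ct st] := acos_unit u (mulr_ge0 q0 sl0).
set t := acos _ in t0 tpi ct st.
exists (a + t); last first.
  apply/esym/cis_phase; rewrite cosD sinD ct st xz yz -xa -ya -xb -yb cosD sinD.
  by split; ring.
rewrite lerDl t0 lerD2l /= leNgt; apply/negP => lt_lt.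
have e : sin (t - l) = - (p * sin l).
  by rewrite sinB ct st; ring.
have [h|h] := ltP (t - l) pi.
  have : 0 < sin (t - l) by apply: sin_gt0_pi; rewrite subr_gt0 lt_lt.
  by rewrite e oppr_gt0 ltNge mulr_ge0.
(* The boundary case [t - l = pi], where the sine gives no contradiction; the cosine gives
   [p + q = -1] instead. *)
have l00 : l = 0 by lra.
have tp : t = pi by lra.
move: ct; rewrite tp cospi l00 cos0; lra.
Qed.

Lemma smallest_arcP x y z : x != phase0 R -> y != phase0 R -> ~ antipodal x y ->
  smallest_arc x y z <-> z != phase0 R /\ cone x y z.
Proof.
move=> x0 y0 xy; have lI := join_length_itv x0 y0 xy.
have /andP[l0 lpi] := lI.
have [a0 ja0] := exists_join x0 y0 xy.
split=> [[a [b [[ab j] m [t /andP[at_ tb] /esym/cis_phase[zx zy]]]]]|[z0 zc]].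
- split; first by apply: unit_phase_neq0; rewrite -zx -zy cos2Dsin2.
  have blt : b - a < pi by apply: le_lt_trans (m _ _ ja0) _; rewrite addrC addKr.
  wlog suff : x y {x0 y0 xy lI l0 lpi a0 ja0 m} j /
      cis a = phase_val x /\ cis b = phase_val y -> cone x y z.
    move=> W; case: (j) => h; first by apply: W.
    by apply: cone_sym; apply: W => //; case: j => h'; [right|left].
  move=> [/cis_phase[xa ya] /cis_phase[xb yb]].
  have [ba|ba] := eqVneq a b.
    have ta : t = a by apply/eqP; rewrite eq_le at_ ba tb.
    by exists 1, 0; rewrite -zx -zy ta xa ya; split => //; ring.
  have sp : 0 < sin (b - a).
    by apply: sin_gt0_pi; rewrite blt subr_gt0 lt_neqAle ba ab.
  (* Spherical interpolation: the coordinates of the unit vector at angle [t] in the basis of those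
     at angles [a] and [b]. *)
  exists (sin (b - t) / sin (b - a)), (sin (t - a) / sin (b - a)); split.
  + rewrite divr_ge0 ?(ltW sp)//; apply: sin_ge0_pi; apply/andP; split; lra.
  + rewrite divr_ge0 ?(ltW sp)//; apply: sin_ge0_pi; apply/andP; split; lra.
  + have E : cos t * sin (b - a) = sin (b - t) * cos a + sin (t - a) * cos b.
      by rewrite !sinB; ring.
    rewrite -zx -xa -xb -[LHS](mulfK (lt0r_neq0 sp)) E; field.
    exact: lt0r_neq0.
  + have E : sin t * sin (b - a) = sin (b - t) * sin a + sin (t - a) * sin b.
      by rewrite !sinB; ring.
    rewrite -zy -ya -yb -[LHS](mulfK (lt0r_neq0 sp)) E; field.
    exact: lt0r_neq0.
- exists a0, (a0 + join_length x y); split => //.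
    by move=> a' b' j; rewrite addrC addKr join_length_min.
  case: ja0 => _ [[h1 h2]|[h1 h2]]; first exact: (cone_arc lI h1 h2).
  exact: (cone_arc lI h1 h2 z0 (cone_sym zc)).
Qed.

End PhaseAdd.

(** * Iterated sums and open half-planes *)

Section PhaseSum.
Context (R : realType).
Implicit Types (x y z w p q : phase R) (s : seq (phase R)) (A : set (phase R)).

Lemma exists_antipode x : exists2 y, antipodal y x & (y == phase0 R) = (x == phase0 R).
Proof.
have [->|x0] := eqVneq x (phase0 R).
  exists (phase0 R); rewrite ?eqxx //.
  by apply/antipodalP; rewrite px0 py0 oppr0.
have [|y y1 y2] := @exists_phase R (- px x) (- py x).
  by rewrite !sqrrN phase_unit.
exists y; first by apply/antipodalP; rewrite y1 y2 !opprK.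
by apply/negbTE/unit_phase_neq0; rewrite y1 y2 !sqrrN phase_unit.
Qed.

Lemma phase_add0 x : phase_add x (phase0 R) = [set x].
Proof. by rewrite /phase_add eqxx; case: eqP => // ->. Qed.

Lemma phase_add0l x : phase_add (phase0 R) x = [set x].
Proof. by rewrite /phase_add eqxx. Qed.

Lemma phase_add_antipodal x y : x != phase0 R -> antipodal x y ->
  phase_add x y = setT.
Proof.
move=> x0 xy; rewrite /phase_add (negbTE x0) xy eqxx.
by rewrite -phase_val_eq0 xy oppr_eq0 phase_val_eq0 (negbTE x0).
Qed.

Lemma phase_addP x y z : x != phase0 R -> y != phase0 R -> ~ antipodal x y ->
  phase_add x y z <-> z != phase0 R /\ cone x y z.
Proof.
move=> x0 y0 xy; rewrite /phase_add (negbTE x0) (negbTE y0) (introF eqP xy).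
exact: smallest_arcP.
Qed.

Definition zeros s := forall y, y \in s -> y = phase0 R.

Definition det p q := px p * py q - py p * px q.

(* [p] and [q] are the extreme directions of [s], counterclockwise; the sum [A] *)
(* then contains the whole arc between them. *)
Definition spans s A p q :=
  [/\ p != phase0 R, q != phase0 R, ~ antipodal p q & 0 <= det p q] /\
  [/\ p \in s, q \in s, forall y, y \in s -> cone p q y
    & forall z, z != phase0 R -> cone p q z -> A z].

(** The invariant of the fold. In the third case all terms lie in a cone strictly smaller than a
    half-plane. *)
Definition sum_shape s A :=
  [\/ zeros s /\ A = [set phase0 R], A = setT | exists p q, spans s A p q].

Lemma cone_l p q : cone p q p.
Proof. by exists 1, 0; split => //; ring. Qed.

Lemma cone_r p q : cone p q q.
Proof. by exists 0, 1; split => //; ring. Qed.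

Lemma cone0 p q : cone p q (phase0 R).
Proof. by exists 0, 0; rewrite px0 py0; split => //; ring. Qed.

Lemma cone_trans p q p' q' z :
  cone p' q' p -> cone p' q' q -> cone p q z -> cone p' q' z.
Proof.
move=> [a [b [a0 b0 h1 h2]]] [c [d [c0 d0 h3 h4]]] [e [f [e0 f0 h5 h6]]].
exists (e * a + f * c), (e * b + f * d).
rewrite h5 h6 h1 h2 h3 h4.
by split; rewrite ?addr_ge0 ?mulr_ge0 //; ring.
Qed.

(** By Lagrange's identity the squares of the inner product and of the determinant add up to 1; a
    zero determinant leaves inner product 1 or -1. *)
Lemma det_eq0 p q : p != phase0 R -> q != phase0 R -> ~ antipodal p q ->
  det p q = 0 -> p = q.
Proof.
move=> p0 q0 pq d0; have pu := phase_unit p0; have qu := phase_unit q0.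
have h : (px p * px q + py p * py q) ^+ 2 = 1.
  have <- : (px p ^+ 2 + py p ^+ 2) * (px q ^+ 2 + py q ^+ 2) = 1.
    by rewrite pu qu mulr1.
  by rewrite [RHS](_ : _ = (px p * px q + py p * py q) ^+ 2 + det p q ^+ 2);
    [rewrite d0; ring|rewrite /det; ring].
have qE : px q = px p * (px p * px q + py p * py q) /\
          py q = py p * (px p * px q + py p * py q).
  split; rewrite -[LHS]mul1r -pu.
    transitivity (px p * (px p * px q + py p * py q) - py p * det p q).
      by rewrite /det; ring.
    by rewrite d0; ring.
  transitivity (py p * (px p * px q + py p * py q) + px p * det p q).
    by rewrite /det; ring.
  by rewrite d0; ring.
move/eqP: h; rewrite sqrf_eq1 => /orP[] /eqP c1; move: qE; rewrite c1.
  by rewrite !mulr1 => -[h1 h2]; apply: phaseP.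
by rewrite !mulrN1 => h; case: pq; apply/antipodalP.
Qed.

Lemma cone_scale p q z (d a b : R) : 0 < d -> 0 <= a -> 0 <= b ->
  d * px z = a * px p + b * px q -> d * py z = a * py p + b * py q ->
  cone p q z.
Proof.
move=> d0 a0 b0 h1 h2; have dn := lt0r_neq0 d0.
exists (a / d), (b / d); rewrite !divr_ge0 ?(ltW d0) //; split => //.
  by apply: (mulfI dn); rewrite h1; field.
by apply: (mulfI dn); rewrite h2; field.
Qed.

(* By the signs in Cramer's rule det q y * p + det y p * q + det p q * y = 0. *)
Lemma three_directions p q y : p != phase0 R -> q != phase0 R ->
  y != phase0 R -> ~ antipodal p q -> ~ antipodal p y -> ~ antipodal q y ->
  0 <= det p q ->
  [\/ cone p q y, exists2 y', antipodal y' y & cone p q y',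
      cone p y q /\ 0 <= det p y | cone y q p /\ 0 <= det y q].
Proof.
move=> p0 q0 y0 pq py_ qy d0.
have Cx : det p q * px y = - det q y * px p - det y p * px q.
  by rewrite /det; ring.
have Cy : det p q * py y = - det q y * py p - det y p * py q.
  by rewrite /det; ring.
have detC u v : det u v = - det v u by rewrite /det; ring.
move: d0; rewrite le_eqVlt => /orP[/eqP/esym d0|d0].
  have {}pq := det_eq0 p0 q0 pq d0; subst q.
  have [h|h] := leP 0 (det p y).
    by apply: Or43; split => //; exact: cone_l.
  by apply: Or44; split; [exact: cone_r|rewrite detC oppr_ge0 ltW].
have [h1|h1] := leP (det q y) 0; have [h2|h2] := leP (det y p) 0.
- apply: Or41; apply: (@cone_scale _ _ _ _ (- det q y) (- det y p) d0);
    rewrite ?oppr_ge0 //.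
    by rewrite Cx; ring.
  by rewrite Cy; ring.
- apply: Or44; split; last by rewrite detC oppr_ge0.
  have n0 : 0 < - det q y.
    rewrite oppr_gt0 lt_neqAle h1 andbT; apply/eqP => /(det_eq0 q0 y0 qy) qyE.
    by move: h2; rewrite -qyE detC oppr_gt0 ltNge ltW.
  apply: (@cone_scale _ _ _ _ (det p q) (det y p) n0); rewrite ?ltW //.
    by rewrite Cx; ring.
  by rewrite Cy; ring.
- apply: Or43; split; last by rewrite detC oppr_ge0.
  have n0 : 0 < - det y p.
    rewrite oppr_gt0 lt_neqAle h2 andbT detC oppr_eq0.
    apply/eqP => /(det_eq0 p0 y0 py_) pyE.
    by move: h1; rewrite -pyE detC oppr_gt0 ltNge ltW.
  apply: (@cone_scale _ _ _ _ (det q y) (det p q) n0); rewrite ?ltW //.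
    by rewrite Cx; ring.
  by rewrite Cy; ring.
- have [y' /antipodalP[h3 h4] _] := exists_antipode y.
  apply: Or42; exists y'; first exact/antipodalP.
  apply: (@cone_scale _ _ _ _ (det q y) (det y p) d0); rewrite ?ltW //.
    by have -> : px y' = - px y; [rewrite h3 opprK|rewrite mulrN Cx; ring].
  by have -> : py y' = - py y; [rewrite h4 opprK|rewrite mulrN Cy; ring].
Qed.

Lemma antipodal_sym x y : antipodal x y -> antipodal y x.
Proof. by move=> /antipodalP[h1 h2]; apply/antipodalP; rewrite h1 h2 !opprK. Qed.

Lemma antipodal_uniq x y z : antipodal x z -> antipodal y z -> x = y.
Proof.
move=> /antipodal_sym/antipodalP[h1 h2] /antipodal_sym/antipodalP[h3 h4].
by apply: phaseP; rewrite ?h1 ?h2 ?h3 ?h4.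
Qed.

(** If the antipode of [y] lies in the cone of the extreme directions, it lies in [A] and the new
    sum is everything. Otherwise no phase of that cone is antipodal to [y], and [three_directions]
    shows that [y] lies in the cone or replaces one extreme direction. *)
Lemma sum_shape_rcons s A y : sum_shape s A ->
  sum_shape (rcons s y) (\bigcup_(w in A) phase_add w y).
Proof.
have [->|y0] := eqVneq y (phase0 R).
  have -> : \bigcup_(w in A) phase_add w (phase0 R) = A.
    under eq_bigcupr do rewrite phase_add0.
    by rewrite bigcup_imset1 image_id.
  have sE z : (z \in rcons s (phase0 R)) -> z \in s \/ z = phase0 R.
    by rewrite mem_rcons inE => /orP[/eqP|]; [right|left].
  case=> [[z0 ->]|->|[p [q [h [ps qs sc cA]]]]].
  - by apply: Or31; split => // z /sE[/z0|].
  - exact: Or32.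
  - apply: Or33; exists p, q; split => //; split => //; rewrite ?mem_rcons ?inE ?ps ?qs ?orbT //.
    by move=> z /sE[/sc//|->]; exact: cone0.
have full B y' : B y' -> antipodal y' y -> \bigcup_(w in B) phase_add w y = setT.
  move=> By' yy'; apply/seteqP; split => // z _; exists y' => //.
  rewrite phase_add_antipodal //.
  apply: contra_neq y0 => y'0; apply: phaseP.
    by move/antipodalP: yy' => [-> _]; rewrite y'0 px0 oppr0.
  by move/antipodalP: yy' => [_ ->]; rewrite y'0 py0 oppr0.
have yy : ~ antipodal y y.
  by move=> /antipodalP[h1 h2]; have := phase_unit y0; nra.
have [y' yy' y'0] := exists_antipode y; rewrite (negbTE y0) in y'0.
case=> [[z0 ->]|->|[p [q [[p0 q0 pq d0] [ps qs sc cA]]]]].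
- rewrite bigcup_set1 phase_add0l; apply: Or33; exists y, y; split; split => //.
  + by rewrite /det; lra.
  + by rewrite mem_rcons mem_head.
  + by rewrite mem_rcons mem_head.
  + move=> z; rewrite mem_rcons inE => /orP[/eqP->|/z0 ->]; [exact: cone_l|exact: cone0].
  (* A nonzero phase in the cone of [y] with itself is parallel to [y] and not antipodal to it,
     hence equal to it. *)
  + move=> z zn0 [a [b [a0 b0 h1 h2]]]; apply: contrapT => zy.
    have yz : ~ antipodal y z.
      move=> /antipodalP[h3 h4]; move: (phase_unit y0) => u.
      have : (1 + (a + b)) * (px y ^+ 2 + py y ^+ 2) = 0.
        have e1 : (1 + (a + b)) * px y = 0 by lra.
        have e2 : (1 + (a + b)) * py y = 0 by lra.
        by rewrite mulrDr !expr2 !mulrA e1 e2; ring.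
      by rewrite u; lra.
    apply: zy; apply/esym/(det_eq0 y0 zn0 yz).
    by rewrite /det h1 h2; ring.
- by rewrite (full _ y') //; apply: Or32.
have [ypE|py_] := pselect (antipodal p y).
  by rewrite (full _ p) //; [apply: Or32|apply: cA => //; exact: cone_l].
have [yqE|qy] := pselect (antipodal q y).
  by rewrite (full _ q) //; [apply: Or32|apply: cA => //; exact: cone_r].
have [ycE|yc] := pselect (cone p q y').
  by rewrite (full _ y') //; [apply: Or32|apply: cA => //; rewrite y'0].
have notap w : cone p q w -> ~ antipodal w y.
  by move=> wc wy; apply: yc; rewrite -(antipodal_uniq wy yy').
have spans_new p' q' : (forall w, cone p q w -> cone p' q' w) ->
    p' != phase0 R -> q' != phase0 R -> ~ antipodal p' q' -> 0 <= det p' q' ->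
    p' \in rcons s y -> q' \in rcons s y -> cone p' q' y ->
    (forall z, z != phase0 R -> cone p' q' z -> (\bigcup_(w in A) phase_add w y) z) ->
    sum_shape (rcons s y) (\bigcup_(w in A) phase_add w y).
  move=> mono p'0 q'0 pq' d' p's q's yc' cov; apply: Or33; exists p', q'.
  split; split => // z; rewrite mem_rcons inE => /orP[/eqP->//|/sc].
  exact: mono.
have mem_s z : z \in s -> z \in rcons s y by rewrite mem_rcons inE orbC => ->.
have mem_y : y \in rcons s y by rewrite mem_rcons mem_head.
have addP w z : A w -> w != phase0 R -> ~ antipodal w y -> z != phase0 R ->
    cone w y z -> (\bigcup_(w in A) phase_add w y) z.
  by move=> Aw w0 wy z0 zc; exists w => //; apply/phase_addP.
case: (three_directions p0 q0 y0 pq py_ qy d0) => [h|[y'' yy'' h]|[h d']|[h d']].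
- apply: (spans_new p q) => //; try exact: mem_s.
  (* The extreme directions are unchanged, and [z] is an endpoint of the arc joining [z] and [y]. *)
  move=> z z0 zc; apply: (addP z) => //; [exact: cA|exact: notap|exact: cone_l].
- by case: yc; rewrite (antipodal_uniq yy' yy'').
- apply: (spans_new p y) => //; try exact: mem_s; try exact: cone_r.
    by move=> w; apply: cone_trans => //; exact: cone_l.
  (* The single summand [p] suffices: its arc to [y] is the whole new arc. *)
  move=> z z0 zc; apply: (addP p) => //; apply: cA => //; exact: cone_l.
- apply: (spans_new y q) => //; try exact: mem_s; try exact: cone_l.
  + by move=> w; apply: cone_trans => //; exact: cone_r.
  + by move/antipodal_sym.
  + move=> z z0 zc; apply: (addP q) => //; last exact: cone_sym.
    by apply: cA => //; exact: cone_r.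
Qed.

Lemma sum_shape1 x : sum_shape [:: x] [set x].
Proof.
have [->|x0] := eqVneq x (phase0 R).
  by apply: Or31; split => // y; rewrite inE => /eqP.
have h : sum_shape [::] [set phase0 R] by apply: Or31; split.
by have := sum_shape_rcons x h; rewrite bigcup_set1 phase_add0l.
Qed.

Lemma phase_sum_shape s : sum_shape s (phase_sum s).
Proof.
case: s => [|x s]; first by apply: Or31; split.
rewrite /phase_sum -cat1s.
elim: s [:: x] [set x] (sum_shape1 x) => [|y s IH] s0 A h /=; first by rewrite cats0.
by rewrite -cat_rcons; apply: IH; exact: sum_shape_rcons.
Qed.

Definition half_plane (a b : R) := [set x : phase R | 0 < a * px x + b * py x].

(** An open half-plane contains no antipodal pair and is closed under nonzero nonnegative
    combinations, so each addition stays inside it. *)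
Lemma phase_sum_half_plane (a b : R) s :
  (forall y, y \in s -> y != phase0 R -> half_plane a b y) ->
  zeros s \/ phase_sum s `<=` half_plane a b.
Proof.
(* Until the first nonzero term the partial sum is {0}, which lies in no open half-plane; hence the
   disjunction. *)
pose Q s A := zeros s /\ A `<=` [set phase0 R] \/ A `<=` half_plane a b.
have hp0 y : half_plane a b y -> y != phase0 R.
  by apply: contraPneq => ->; rewrite /half_plane/= px0 py0 !mulr0 addr0 ltxx.
have step s0 A y : Q s0 A -> (y != phase0 R -> half_plane a b y) ->
    Q (rcons s0 y) (\bigcup_(w in A) phase_add w y).
  have [-> + _|y0 + /(_ isT) hy] := eqVneq y (phase0 R).
    have -> : \bigcup_(w in A) phase_add w (phase0 R) = A.
      under eq_bigcupr do rewrite phase_add0.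
      by rewrite bigcup_imset1 image_id.
    case=> [[z0 A0]|]; [left; split => // z|by right].
    by rewrite mem_rcons inE => /orP[/eqP|/z0].
  case=> [[_ A0]|A0]; right => z [w /A0 h].
    by rewrite h phase_add0l => ->.
  move: (h) => /hp0 w0.
  have wy : ~ antipodal w y.
    move=> /antipodalP[h1 h2]; move: h hy; rewrite /half_plane/= h1 h2; lra.
  move/(phase_addP _ w0 y0 wy) => [z0 [c [d [c0 d0 zx zy]]]].
  rewrite /half_plane/= zx zy.
  move: h hy; rewrite /half_plane/=; set W := a * px w + _; set Y := a * px y + _ => W0 Y0.
  have -> : a * (c * px w + d * px y) + b * (c * py w + d * py y) = c * W + d * Y.
    by rewrite /W /Y; ring.
  have [c00|cn] := eqVneq c 0.
    have [d00|dn] := eqVneq d 0.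
      case/negP: z0; apply/eqP/phaseP; rewrite ?zx ?zy c00 d00 ?px0 ?py0; ring.
    by rewrite c00 mul0r add0r mulr_gt0 // lt_neqAle eq_sym dn.
  by rewrite ltr_wpDr ?mulr_ge0 ?(ltW Y0) // mulr_gt0 // lt_neqAle eq_sym cn.
case: s => [|x s] hs; first by left.
suff : Q (x :: s) (phase_sum (x :: s)) by case=> [[]|]; [left|right].
rewrite /phase_sum -cat1s.
have : Q [:: x] [set x].
  have [->|x0] := eqVneq x (phase0 R).
    by left; split => // y; rewrite inE => /eqP.
  by right => _ ->; apply: hs => //; rewrite mem_head.
have : forall y, y \in s -> y != phase0 R -> half_plane a b y.
  by move=> y ys; apply: hs; rewrite inE ys orbT.
elim: s {hs} [:: x] [set x] => [|y s IH] s0 A hs h /=; first by rewrite cats0.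
rewrite -cat_rcons; apply: IH => [z zs|].
  by apply: hs; rewrite inE zs orbT.
by apply: step => //; apply: hs; rewrite mem_head.
Qed.

Lemma phase_sum0P s : ~ zeros s ->
  phase_sum s (phase0 R) <->
  forall a b : R, exists y, [/\ y \in s, y != phase0 R & a * px y + b * py y <= 0].
Proof.
move=> sn0; split => [s0 a b|h].
  apply: contrapT => hn.
  have [y ys y0||/(_ _ s0)] := @phase_sum_half_plane a b s; last 2 first.
  - exact: sn0.
  - by rewrite /half_plane /= px0 py0 !mulr0 addr0 ltxx.
  rewrite /half_plane /= ltNge; apply/negP => le0; apply: hn; by exists y.
case: (phase_sum_shape s) => [[]//|-> //|[p [q [[p0 q0 pq d0] [ps qs sc cA]]]]].
have pu := phase_unit p0; have qu := phase_unit q0.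
(* The bisector [p + q] pairs with a phase [a * p + b * q] of the cone to [(a + b) * (1 + c)], and
   [1 + c] is positive because [p] and [q] are not antipodal. So only the zero phase could give a
   value at most 0. *)
have [y [ys y0]] := h (px p + px q) (py p + py q).
have yu := phase_unit y0.
have [a [b [a0 b0 yx yy]]] := sc _ ys.
set c := px p * px q + py p * py q.
have -> : (px p + px q) * px y + (py p + py q) * py y = (a + b) * (1 + c).
  rewrite yx yy.
  transitivity ((a + b) * c + a * (px p ^+ 2 + py p ^+ 2) + b * (px q ^+ 2 + py q ^+ 2)).
    by rewrite /c; ring.
  by rewrite qu pu; ring.
have c1 : 0 < 1 + c.
  have e : 2 * (1 + c) = (px p + px q) ^+ 2 + (py p + py q) ^+ 2.
    transitivity (2 * c + (px p ^+ 2 + py p ^+ 2) + (px q ^+ 2 + py q ^+ 2)).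
      by rewrite pu qu; ring.
    by rewrite /c; ring.
  rewrite lt_neqAle eq_sym; apply/andP; split; last first.
    by have := sqr_ge0 (px p + px q); have := sqr_ge0 (py p + py q); lra.
  apply/eqP => c0; move/eqP: e; rewrite c0 mulr0 eq_sym.
  rewrite paddr_eq0 ?sqr_ge0 // !sqrf_eq0 => /andP[/eqP h1 /eqP h2].
  by apply: pq; apply/antipodalP; split; lra.
rewrite pmulr_lle0 // => ab0.
have a00 : a = 0 by lra.
have b00 : b = 0 by lra.
case/negP: y0; apply/eqP/phaseP; rewrite ?yx ?yy a00 b00 ?px0 ?py0; ring.
Qed.

End PhaseSum.

(** * The space of covectors *)

Section Continuity.
Context (R : realType) (T : topologicalType).

Lemma sum_continuous (I : Type) (r : seq I) (F : I -> T -> R) :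
  (forall i, continuous (F i)) -> continuous (fun x => \sum_(i <- r) F i x).
Proof.
move=> cF; elim: r => [|i r IH].
  rewrite (_ : (fun x => _) = fun=> 0); first exact: cst_continuous.
  by apply: funext => x; rewrite big_nil.
rewrite (_ : (fun x => _) = fun x => F i x + \sum_(i <- r) F i x).
  by move=> x; apply: cvgD; [exact: cF|exact: IH].
by apply: funext => x; rewrite big_cons.
Qed.

Lemma row_continuous n (f : T -> 'rV[R]_n) :
  (forall j, continuous (fun x => f x ord0 j)) -> continuous f.
Proof.
move=> cf x A [B fB BA].
have : \forall y \near x, forall j : 'I_n, B ord0 j (f y ord0 j).
  by apply: filter_forall => j; apply: cf; exact: fB.
apply: filterS => y yB; apply: BA => i j; rewrite ord1; exact: yB.
Qed.

Lemma linear_continuous2 (a b : R) (f g : T -> R) : continuous f -> continuous g ->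
  continuous (fun x => a * f x + b * g x).
Proof.
move=> cf cg x; apply: cvgD; apply: cvgM; by [exact: cvg_cst|exact: cf|exact: cg].
Qed.

Lemma sqr_sum_continuous (f g : T -> R) : continuous f -> continuous g ->
  continuous (fun x => f x ^+ 2 + g x ^+ 2).
Proof.
move=> cf cg x; apply: cvgD.
  apply: (@continuous_comp _ _ _ f (fun t : R => t ^+ 2)); first exact: cf.
  exact: exprn_continuous.
apply: (@continuous_comp _ _ _ g (fun t : R => t ^+ 2)); first exact: cg.
exact: exprn_continuous.
Qed.

Lemma closed_fun_le (f g : T -> R) : continuous f -> continuous g ->
  closed [set x | f x <= g x].
Proof.
move=> cf cg; have -> : [set x | f x <= g x] = (fun x => g x - f x) @^-1` [set y | 0 <= y].
  by apply/seteqP; split => x /=; rewrite subr_ge0.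
have cc : continuous (fun x => g x - f x).
  by move=> x; apply: cvgB; [exact: cg|exact: cf].
by apply: ((iffLR (continuous_closedP _)) cc); exact: closed_ge.
Qed.

Lemma closed_fun_eq (f g : T -> R) : continuous f -> continuous g ->
  closed [set x | f x = g x].
Proof.
move=> cf cg; have -> : [set x | f x = g x] =
    [set x | f x <= g x] `&` [set x | g x <= f x].
  apply/seteqP; split => x /=; first by move=> ->.
  by move=> [h1 h2]; apply/eqP; rewrite eq_le h1.
by apply: closedI; exact: closed_fun_le.
Qed.

End Continuity.

(** * Covectors by half-planes, and compactness *)

Section Perp.
Context (R : realType) (n : nat) (v : 'I_n -> phase R).
Context (hv : forall i, circle (phase_val (v i))).
Implicit Types x y : 'I_n -> phase R.

Lemma v_unit i : px (v i) ^+ 2 + py (v i) ^+ 2 = 1.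
Proof. by apply/circleE; exact: hv. Qed.

(* Real and imaginary parts of [v_i * x_i]. *)
Definition vx x i : R := px (phase_mul (v i) (x i)).
Definition vy x i : R := py (phase_mul (v i) (x i)).

Lemma vxy_sqr x i : vx x i ^+ 2 + vy x i ^+ 2 = px (x i) ^+ 2 + py (x i) ^+ 2.
Proof.
rewrite /vx /vy px_mul py_mul -[RHS]mul1r -(v_unit i); ring.
Qed.

Lemma vxy0 x i : x i = phase0 R -> vx x i = 0 /\ vy x i = 0.
Proof. by rewrite /vx /vy px_mul py_mul => ->; rewrite px0 py0; split; ring. Qed.

Lemma vxy_inj x y i : vx x i = vx y i -> vy x i = vy y i -> x i = y i.
Proof.
rewrite /vx /vy !px_mul !py_mul => h1 h2; have u := v_unit i.
apply: phaseP; rewrite -[LHS]mul1r -[RHS]mul1r -u.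
  transitivity (px (v i) * (px (v i) * px (x i) - py (v i) * py (x i)) +
    py (v i) * (px (v i) * py (x i) + py (v i) * px (x i))); first by ring.
  by rewrite h1 h2; ring.
transitivity (px (v i) * (px (v i) * py (x i) + py (v i) * px (x i)) -
  py (v i) * (px (v i) * px (x i) - py (v i) * py (x i))); first by ring.
by rewrite h1 h2; ring.
Qed.

Lemma exists_vxy i (a b : R) : a ^+ 2 + b ^+ 2 = 1 -> exists p : phase R,
  px (phase_mul (v i) p) = a /\ py (phase_mul (v i) p) = b.
Proof.
move=> ab; have u := v_unit i.
have [|p p1 p2] := @exists_phase R (px (v i) * a + py (v i) * b)
    (px (v i) * b - py (v i) * a).
  rewrite -[LHS](_ : (px (v i) ^+ 2 + py (v i) ^+ 2) * (a ^+ 2 + b ^+ 2) = _).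
    by rewrite u ab mulr1.
  by ring.
exists p; rewrite px_mul py_mul p1 p2.
by split; rewrite -[RHS]mul1r -u; ring.
Qed.

(** The instance [a = b = 0] asks only for a nonzero entry and so accounts for the removal of the
    zero vector. *)
Lemma perpP x : (perp v `\ (fun=> phase0 R)) x <->
  forall a b : R, exists2 i, x i != phase0 R & a * vx x i + b * vy x i <= 0.
Proof.
set s := [seq phase_mul (v i) (x i) | i <- enum 'I_n].
have mem_s i : phase_mul (v i) (x i) \in s by apply: map_f; rewrite mem_enum.
have neq0 i : (phase_mul (v i) (x i) != phase0 R) = (x i != phase0 R).
  apply/idP/idP; apply: contraNneq => h.
    by have [h1 h2] := vxy0 h; apply/eqP/phaseP.
  apply/eqP/phaseP; apply/eqP; rewrite ?px0 ?py0 -sqrf_eq0 eq_le sqr_ge0 andbT.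
    have := vxy_sqr x i; rewrite /vx /vy h px0 py0.
    by have := sqr_ge0 (py (x i)); rewrite expr0n /=; lra.
  have := vxy_sqr x i; rewrite /vx /vy h px0 py0.
  by have := sqr_ge0 (px (x i)); rewrite expr0n /=; lra.
have main : ~ zeros s -> perp v x <->
    forall a b : R, exists2 i, x i != phase0 R & a * vx x i + b * vy x i <= 0.
  move=> s0; apply: iff_trans (phase_sum0P s0) _.
  split => h a b; have := h a b.
    by move=> [_ [/mapP[i _ ->] h1 h2]]; exists i; rewrite -?neq0.
  by move=> [i h1 h2]; exists (phase_mul (v i) (x i)); rewrite neq0.
split => [[xp x0]|h].
  apply/main => // s0; apply: x0; apply: funext => i.
  by apply/eqP; apply/negPn; rewrite -neq0 (s0 _ (mem_s i)) eqxx.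
have [i i0 _] := h 0 0.
split; last by move=> xE; move: i0; rewrite xE eqxx.
by apply/main => // s0; move: i0; rewrite -neq0 (s0 _ (mem_s i)) eqxx.
Qed.

Lemma eval_continuous i : continuous (fun x => x i).
Proof. exact: (@proj_continuous _ (fun _ => phase R) i). Qed.

Lemma pxi_continuous i : continuous (fun x => px (x i)).
Proof.
move=> x; apply: (@continuous_comp _ _ _ (fun x => x i) (@px R)).
  exact: eval_continuous.
exact: px_continuous.
Qed.

Lemma pyi_continuous i : continuous (fun x => py (x i)).
Proof.
move=> x; apply: (@continuous_comp _ _ _ (fun x => x i) (@py R)).
  exact: eval_continuous.
exact: py_continuous.
Qed.

Lemma vx_continuous i : continuous (vx^~ i).
Proof.
have -> : vx^~ i = (fun x => px (v i) * px (x i) + (- py (v i)) * py (x i)).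
  by apply: funext => x; rewrite /vx px_mul mulNr.
by apply: linear_continuous2; [exact: pxi_continuous|exact: pyi_continuous].
Qed.

Lemma vy_continuous i : continuous (vy^~ i).
Proof.
have -> : vy^~ i = (fun x => px (v i) * py (x i) + py (v i) * px (x i)).
  by apply: funext => x; rewrite /vy py_mul.
by apply: linear_continuous2; [exact: pyi_continuous|exact: pxi_continuous].
Qed.

(** For fixed [a] and [b] the half-plane condition is a finite union over [i]. Being nonzero is a
    closed condition because phases have modulus 0 or 1; [E] writes it as an equation. *)
Lemma compact_perp : compact (perp v `\ (fun=> phase0 R)).
Proof.
have cT : compact [set: 'I_n -> phase R].
  have := @tychonoff _ (fun _ : 'I_n => phase R) _ (fun=> @compact_phase R).
  by congr (compact _); apply/seteqP; split.
apply: subclosed_compact cT _ => //.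
pose E (a b : R) i := [set x | px (x i) ^+ 2 + py (x i) ^+ 2 = 1] `&`
  [set x | a * vx x i + b * vy x i <= 0].
have -> : perp v `\ (fun=> phase0 R) =
    \bigcap_(ab in [set: R * R]) \bigcup_(i in [set: 'I_n]) E ab.1 ab.2 i.
  apply/seteqP; split => x.
    move=> /perpP h [a b] _; have [i i0 hi] := h a b.
    by exists i => //; split => //=; exact: phase_unit.
  move=> h; apply/perpP => a b; have [i _ [/= u hi]] := h (a, b) I.
  by exists i => //; exact: unit_phase_neq0.
apply: closed_bigI => ab _; apply: closed_bigcup => [|i _]; first exact: finite_finset.
apply: closedI.
  apply: closed_fun_eq; last exact: cst_continuous.
  by apply: sqr_sum_continuous; [exact: pxi_continuous|exact: pyi_continuous].
apply: closed_fun_le; last exact: cst_continuous.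
by apply: linear_continuous2; [exact: vx_continuous|exact: vy_continuous].
Qed.

End Perp.

(** * Nondegenerate cells of the order complex *)

Lemma pair_continuous (T U V : topologicalType) (f : T -> U) (g : T -> V) :
  continuous f -> continuous g -> continuous (fun x => (f x, g x)).
Proof. by move=> cf cg x; apply: cvg_pair; [exact: cf|exact: cg]. Qed.

Section OrderComplexReduction.
Context (R : realType) d (P : topPosetType d).

(** Pushing weights forward is adjoint to reindexing values, so averages over a chain respect both
    kinds of gluing. *)
Lemma push_row_sum m k (f : 'I_m.+1 -> 'I_k.+1) (t : 'rV[R]_m.+1) (G : 'I_k.+1 -> R) :
  \sum_b push_row f t ord0 b * G b = \sum_a t ord0 a * G (f a).
Proof.
rewrite [RHS](partition_big f predT) //=; apply: eq_bigr => b _.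
rewrite mxE big_distrl /=; apply: eq_bigr => a /eqP ->.
by [].
Qed.

Lemma simplex_ge0 k (t : simplex R k) j : 0 <= (set_val t) ord0 j.
Proof. by have [h _] := set_valP t; exact: h. Qed.

Lemma simplex_sum k (t : simplex R k) : \sum_j (set_val t) ord0 j = 1.
Proof. by have [_ h] := set_valP t. Qed.

(** Comparing neighbours is enough: in a monotone chain, distinct neighbours make all entries
    distinct. *)
Definition nondegenerate k (x : chain P k) (t : simplex R k) : Prop :=
  (forall i j : 'I_k.+1, (i.+1 = j)%N -> set_val x i <> set_val x j) /\
  (forall j, 0 < (set_val t) ord0 j).

Lemma set_val_inj (T : Type) (A : set T) (x y : A) : set_val x = set_val y -> x = y.
Proof.
case: x y => [x xA] [y yA]; rewrite !set_valE /= => e; subst y.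
by congr exist; exact: bool_irrelevance.
Qed.

(** Descent on the dimension: a zero weight makes [t] a coface and equal neighbours make [x] a
    degeneracy. Either way the cell is glued to one of lower dimension. *)
Lemma glued_nondegenerate k (x : chain P k) (t : simplex R k) :
  exists k' (x' : chain P k') (t' : simplex R k'),
    glued (cell x t) (cell x' t') /\ nondegenerate x' t'.
Proof.
elim: k x t => [|k IH] x t.
  exists 0%N, x, t; split; first exact: glued_refl.
  split; first by move=> i j; rewrite !ord1.
  move=> j; have := simplex_sum t; rewrite (bigD1 j) //= big1 => [|i]; last by rewrite !ord1.
  by rewrite addr0 => ->.
have glue (c : cells R P) : gluing (cell x t) c \/ gluing c (cell x t) ->
    (exists k' (x' : chain P k') (t' : simplex R k'),
      glued c (cell x' t') /\ nondegenerate x' t') ->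
    exists k' (x' : chain P k') (t' : simplex R k'),
      glued (cell x t) (cell x' t') /\ nondegenerate x' t'.
  move=> g [k' [x' [t' [g' nd]]]]; exists k', x', t'; split => //.
  apply: glued_trans g'; apply/asboolP; case: g => g; first exact: rst_step.
  by apply: rst_sym; exact: rst_step.
have [[i ti0]|tn0] := pselect (exists i, (set_val t) ord0 i = 0).
  pose t1 : 'rV[R]_k.+1 := \row_j (set_val t) ord0 (lift i j).
  have t1s : t1 \in simplex R k.
    apply/mem_set; split => [j|]; first by rewrite mxE simplex_ge0.
    rewrite -(simplex_sum t) (bigD1_ord i) //= ti0 add0r.
    by apply: eq_bigr => j _; rewrite mxE.
  pose t' : simplex R k := exist _ t1 t1s.
  have tE : t = coface i t'.
    apply: set_val_inj; apply/rowP => b; rewrite !set_valE /= mxE.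
    case: (unliftP i b) => [b' ->|->].
      rewrite (big_pred1 b') => [|a]; first by rewrite mxE.
      by rewrite /= (inj_eq lift_inj).
    rewrite big_pred0 => [|a]; last by rewrite eq_sym; apply/negbTE/neq_lift.
    by rewrite -ti0 set_valE.
  apply: (glue (cell (face i x) t')); last exact: IH.
  by right; rewrite [in cell x t]tE; exact: gluing_face.
have [[i xi]|xn] := pselect (exists i : 'I_k.+1,
    set_val x (widen_ord (leqnSn _) i) = set_val x (lift ord0 i)).
  pose x' := face (widen_ord (leqnSn _) i) x.
  have xE : x = degeneracy i x'.
    apply: set_val_inj; apply: funext => j.
    change (set_val x j = set_val x (lift (widen_ord (leqnSn k.+1) i) (merge_ord i j))).
    (* Merging and then skipping [i] fixes every position except [i], which moves to [i + 1]; there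
       [x] has the same entry by [xi]. *)
    have jE : lift (widen_ord (leqnSn k.+1) i) (merge_ord i j) =
        (if j == i :> nat then lift ord0 i else j) :> nat.
      rewrite /= merge_ordE; case: eqP => [->|/eqP ji].
        by rewrite /unbump ltnn subn0 /bump leqnn.
      by rewrite unbumpKcond; case: eqP ji => // ->; rewrite eqxx.
    move: jE; case: eqP => [ji jE|_ jE].
      rewrite (_ : lift _ _ = lift ord0 i); last exact: val_inj.
      rewrite (_ : j = widen_ord (leqnSn _) i); last exact: val_inj.
      exact: xi.
    by congr (set_val x _); apply/esym/val_inj.
  apply: (glue (cell x' (codegeneracy i t))); last exact: IH.
  by left; rewrite [in cell x t]xE; exact: gluing_degeneracy.
exists k.+1, x, t; split; first exact: glued_refl.
split => [i j ij xij|j]; last first.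
  rewrite lt_neqAle simplex_ge0 andbT eq_sym; apply/eqP => h.
  by apply: tn0; exists j.
have ik : (i < k.+1)%N by have := ltn_ord j; rewrite -ij.
apply: xn; exists (Ordinal ik).
rewrite (_ : widen_ord _ _ = i); last exact: val_inj.
by rewrite xij; congr (set_val x _); apply: val_inj; rewrite /= -ij.
Qed.

Lemma compact_chain k : compact [set: P] -> compact [set: chain P k].
Proof.
move=> cP; apply: compact_set_type.
have cT : compact [set: 'I_k.+1 -> P].
  have := @tychonoff _ (fun _ : 'I_k.+1 => P) _ (fun=> cP).
  by congr (compact _); apply/seteqP; split.
apply: subclosed_compact cT _ => //.
have -> : chain P k = \bigcap_(ij in [set ij : 'I_k.+1 * 'I_k.+1 | (ij.1 <= ij.2)%N])
    ((fun x : 'I_k.+1 -> P => (x ij.1, x ij.2)) @^-1`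
      [set ab : P * P | (ab.1 <= ab.2)%O]).
  apply/seteqP; split => x.
    by move=> h [i j] /= ij; exact: h.
  by move=> h i j ij; exact: (h (i, j)).
apply: closed_bigI => -[i j] _.
have /continuous_closedP : continuous (fun x : 'I_k.+1 -> P => (x i, x j)).
  have c l : continuous (fun x : 'I_k.+1 -> P => x l).
    exact: (@proj_continuous _ (fun _ => P) l).
  by apply: pair_continuous; exact: c.
by apply; exact: topposet_closed_le.
Qed.

Lemma compact_simplex k : compact [set: simplex R k].
Proof.
apply: compact_set_type.
have cT : compact [set t : 'rV[R]_k.+1 | forall j, `[0 : R, 1]%classic (t ord0 j)].
  by apply: (@rV_compact _ _ (fun=> `[0 : R, 1]%classic)) => _; exact: segment_compact.
apply: subclosed_compact cT _.
- have -> : simplex R k = \bigcap_(i in [set: 'I_k.+1]) [set t | 0 <= t ord0 i] `&`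
      [set t | \sum_i t ord0 i = 1].
    by apply/seteqP; split => t [h1 h2]; split => // i *; exact: h1.
  apply: closedI.
    apply: closed_bigI => i _; apply: closed_fun_le; first exact: cst_continuous.
    exact: coord_continuous.
  apply: closed_fun_eq; last exact: cst_continuous.
  by apply: sum_continuous => i; exact: coord_continuous.
- move=> t [t0 t1] j /=; rewrite in_itv /= t0 -t1 (bigD1 j) //= lerDl.
  by apply: sumr_ge0 => i _; exact: t0.
Qed.

Lemma compact_order_complex n : compact [set: P] ->
  (forall k (x : chain P k) (t : simplex R k), nondegenerate x t -> (k < n)%N) ->
  compact [set: order_complex R P].
Proof.
move=> cP small.
pose q : cells R P -> order_complex R P := \pi_(order_complex R P)%qT.
have cq : continuous q by exact: pi_continuous.
pose F k := [set q (cell xt.1 xt.2) | xt in [set: chain P k * simplex R k]].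
have -> : [set: order_complex R P] = \big[setU/set0]_(k < n) F k.
  apply/seteqP; split => // c _; rewrite -(bigcup_mkord n F).
  rewrite -[c]reprK; case: (repr c) => k [x t].
  have [k' [x' [t' [g nd]]]] := glued_nondegenerate x t.
  exists k'; first exact: small nd.
  exists (x', t') => //=; apply/eqmodP.
  by rewrite /glued_equiv /=; change (glued (cell x' t') (cell x t)); rewrite glued_sym.
apply: bigsetU_compact => k _; apply: continuous_compact.
  apply: continuous_subspaceT => xt.
  apply: (@continuous_comp _ _ _ (fun xt : chain P k * simplex R k => cell xt.1 xt.2) q).
    rewrite (_ : (fun _ => _) = existT (fun k => (chain P k * simplex R k)%type) k).
      exact: existT_continuous.
    by apply: funext => -[].
  exact: cq.
rewrite -setXTT; apply: compact_setX; [exact: compact_chain|exact: compact_simplex].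
Qed.

End OrderComplexReduction.

(** * Realization in C^n *)

Section Realization.
Context (R : realType) (n : nat) (v : 'I_n -> phase R).
Context (hv : forall i, circle (phase_val (v i))).

Local Notation Q := (set_type (perp v `\ (fun=> phase0 R))).

Definition covec k (x : chain Q k) (j : 'I_k.+1) : 'I_n -> phase R :=
  set_val (set_val x j).

(* [Fx c + i Fy c] is the point of C^n obtained by replacing each covector of the *)
(* chain by its entrywise product with [v] and averaging with the given weights; *)
(* its entries have moduli [level c]. *)
Definition Fx (c : cells R Q) (i : 'I_n) : R :=
  let: existT k (x, t) := c in \sum_j (set_val t) ord0 j * vx v (covec x j) i.
Definition Fy (c : cells R Q) (i : 'I_n) : R :=
  let: existT k (x, t) := c in \sum_j (set_val t) ord0 j * vy v (covec x j) i.
Definition level (c : cells R Q) (i : 'I_n) : R :=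
  let: existT k (x, t) := c in
  \sum_j (set_val t) ord0 j * (covec x j i != phase0 R)%:R.

Lemma covec_le k (x : chain Q k) (j l : 'I_k.+1) i : (j <= l)%N ->
  covec x j i = phase0 R \/ covec x j i = covec x l i.
Proof.
move=> jl; have := set_valP x j l jl; rewrite leEsub => /lefP /(_ i).
rewrite /Order.le /= /phase_le phase_val_eq0 => /orP[/eqP h|/eqP h].
  by left.
by right.
Qed.

Lemma covec_support k (x : chain Q k) (j l : 'I_k.+1) i : (j <= l)%N ->
  covec x j i != phase0 R -> covec x l i = covec x j i.
Proof. by move=> /(covec_le x i) [->|->//]; rewrite eqxx. Qed.

Lemma covec_last k (x : chain Q k) (j : 'I_k.+1) i :
  covec x j i = if covec x j i != phase0 R then covec x ord_max i else phase0 R.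
Proof.
have jk : (j <= @ord_max k)%N by exact: leq_ord.
by have [//|h] := eqVneq (covec x j i) (phase0 R); rewrite -(covec_support jk h).
Qed.

Lemma covec_perp k (x : chain Q k) j (a b : R) :
  exists2 i, covec x j i != phase0 R & a * vx v (covec x j) i + b * vy v (covec x j) i <= 0.
Proof. by have /(perpP hv) := set_valP (set_val x j); apply. Qed.

Lemma gluing_F a b : gluing a b -> Fx a = Fx b /\ Fy a = Fy b.
Proof.
case=> k i x t; split; apply: funext => l; rewrite /Fx /Fy /=.
- by rewrite -(push_row_sum (lift i) _ (fun j => vx v (covec x j) l)).
- by rewrite -(push_row_sum (lift i) _ (fun j => vy v (covec x j) l)).
- by rewrite -(push_row_sum (merge_ord i) _ (fun j => vx v (covec x j) l)).
- by rewrite -(push_row_sum (merge_ord i) _ (fun j => vy v (covec x j) l)).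
Qed.

Lemma glued_F a b : glued a b -> Fx a = Fx b /\ Fy a = Fy b.
Proof.
move=> /asboolP; elim => [c c' /gluing_F //|//|c c' _ [-> ->] //|].
by move=> c c' c'' _ [-> ->] _ [-> ->].
Qed.

Lemma covec_continuous k (j : 'I_k.+1) : continuous (fun x : chain Q k => covec x j).
Proof.
have c : continuous (fun x : chain Q k => (set_val x : 'I_k.+1 -> Q) j).
  move=> x; apply: (@continuous_comp _ _ _ (set_val : chain Q k -> _) (fun y : 'I_k.+1 -> Q => y j)).
    exact: set_val_continuous.
  exact: (@proj_continuous _ (fun _ => Q) j).
move=> x; apply: (@continuous_comp _ _ _ (fun x : chain Q k => (set_val x : 'I_k.+1 -> Q) j)
  (set_val : Q -> _)); first exact: c.
exact: set_val_continuous.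
Qed.

Lemma weighted_continuous (f : ('I_n -> phase R) -> R) : continuous f ->
  continuous (fun c : cells R Q => let: existT k (x, t) := c in
    \sum_j (set_val t) ord0 j * f (covec x j)).
Proof.
move=> cf.
pose G k (xt : chain Q k * simplex R k) :=
  \sum_j (set_val xt.2) ord0 j * f (covec xt.1 j).
have -> : (fun c : cells R Q => let: existT k (x, t) := c in
    \sum_j (set_val t) ord0 j * f (covec x j)) = unstable.sigT_fun G.
  by apply: funext => -[k [x t]].
apply: sigT_continuous => k; apply: sum_continuous => j xt.
apply: cvgM.
  apply: (@continuous_comp _ _ _ (fun xt : chain Q k * simplex R k => set_val xt.2)
    (fun M : 'rV[R]_k.+1 => M ord0 j)); last exact: coord_continuous.
  apply: (@continuous_comp _ _ _ (fun xt : chain Q k * simplex R k => xt.2)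
    (set_val : simplex R k -> _)); first exact: cvg_snd.
  exact: set_val_continuous.
apply: (@continuous_comp _ _ _ (fun xt : chain Q k * simplex R k => covec xt.1 j) f);
  last exact: cf.
apply: (@continuous_comp _ _ _ (fun xt : chain Q k * simplex R k => xt.1)
  (fun x : chain Q k => covec x j)); first exact: cvg_fst.
exact: covec_continuous.
Qed.

Lemma Fx_continuous i : continuous (Fx^~ i).
Proof.
rewrite (_ : Fx^~ i = fun c : cells R Q => let: existT k (x, t) := c in
    \sum_j (set_val t) ord0 j * vx v (covec x j) i).
  exact: (weighted_continuous (@vx_continuous R n v i)).
by apply: funext => -[k [x t]].
Qed.

Lemma Fy_continuous i : continuous (Fy^~ i).
Proof.
rewrite (_ : Fy^~ i = fun c : cells R Q => let: existT k (x, t) := c in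
    \sum_j (set_val t) ord0 j * vy v (covec x j) i).
  exact: (weighted_continuous (@vy_continuous R n v i)).
by apply: funext => -[k [x t]].
Qed.

(** * Levels and tails of a weighted chain *)

Section Levels.
Context k (x : chain Q k) (t : simplex R k).
Let c : cells R Q := cell x t.
Let u := covec x ord_max.

(** Along a chain the entry at [i] is 0 or always the same phase, so averaging only scales that
    phase by the weight of the covectors nonzero at [i]. *)
Lemma F_level i : Fx c i = level c i * vx v u i /\ Fy c i = level c i * vy v u i.
Proof.
rewrite /Fx /Fy /level /= !mulr_suml.
split; apply: eq_bigr => j _; rewrite -mulrA; congr (_ * _).
  have [e|e] := eqVneq (covec x j i) (phase0 R).
    by have [-> _] := vxy0 v e; rewrite mul0r.
  by rewrite /vx covec_last e mul1r.
have [e|e] := eqVneq (covec x j i) (phase0 R).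
  by have [_ ->] := vxy0 v e; rewrite mul0r.
by rewrite /vy covec_last e mul1r.
Qed.

Lemma level_ge0 i : 0 <= level c i.
Proof. by apply: sumr_ge0 => j _; rewrite mulr_ge0 ?ler0n ?simplex_ge0. Qed.

Lemma level_le1 i : level c i <= 1.
Proof.
rewrite -(simplex_sum t); apply: ler_sum => j _.
by rewrite ler_piMr ?simplex_ge0 //; case: (_ != _).
Qed.

Lemma level_neq0 i : level c i != 0 -> u i != phase0 R.
Proof.
apply: contraNneq => u0; rewrite /level /= big1 // => j _.
by rewrite covec_last -/(u i) u0 if_same eqxx mulr0.
Qed.

Lemma F_sqr i : Fx c i ^+ 2 + Fy c i ^+ 2 = level c i ^+ 2.
Proof.
have [-> ->] := F_level i; rewrite !exprMn -mulrDr (vxy_sqr hv).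
have [->|/level_neq0 u0] := eqVneq (level c i) 0; first by rewrite expr0n mul0r.
by rewrite phase_unit // mulr1.
Qed.

Lemma level_sqrt i : level c i = Num.sqrt (Fx c i ^+ 2 + Fy c i ^+ 2).
Proof. by rewrite F_sqr sqrtr_sqr ger0_norm // level_ge0. Qed.

(** A position in the support of the smallest covector is in the support of all of them, hence has
    level 1 and keeps its phase. The half-plane condition of that covector thus passes to the
    average. *)
Lemma F_image (a b : R) : exists2 i, Fx c i ^+ 2 + Fy c i ^+ 2 = 1 &
  a * Fx c i + b * Fy c i <= 0.
Proof.
have [i x0 h] := covec_perp x ord0 a b.
have xE j : covec x j i = covec x ord0 i by exact: (covec_support _ x0).
have l1 : level c i = 1.
  by rewrite -(simplex_sum t); apply: eq_bigr => j _; rewrite xE x0 mulr1.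
exists i; first by rewrite F_sqr l1 expr1n.
have [-> ->] := F_level i; rewrite l1 !mul1r.
by move: h; rewrite /vx /vy -(xE ord_max).
Qed.

Lemma F_le1 i : Fx c i ^+ 2 + Fy c i ^+ 2 <= 1.
Proof. by rewrite F_sqr expr_le1 // ?level_le1 ?level_ge0. Qed.

(* In a nondegenerate cell the tails are the distinct nonzero levels, which makes *)
(* the cell recoverable from its image. *)
Definition tail (j : nat) : R := \sum_(l : 'I_k.+1 | (j <= l)%N) (set_val t) ord0 l.

Lemma tailS (j : 'I_k.+1) : tail j = (set_val t) ord0 j + tail j.+1.
Proof.
rewrite /tail (bigD1 j) //=; congr (_ + _); apply: eq_bigl => l.
by rewrite andbC ltn_neqAle eq_sym.
Qed.

Context (nd : nondegenerate x t).

Lemma tail_lt (j l : 'I_k.+1) : (j < l)%N -> tail l < tail j.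
Proof.
move=> jl; have [_ t0] := nd; rewrite (tailS j) ltr_pwDl //.
rewrite /tail [leRHS](bigID (fun i : 'I_k.+1 => (l <= i)%N)) /=.
rewrite [X in _ <= X + _](eq_bigl (fun i : 'I_k.+1 => (l <= i)%N)) => [|i].
  by rewrite lerDl sumr_ge0 // => i _; exact: simplex_ge0.
by case: (leqP l i) => [li|_]; rewrite ?andbF // andbT; exact: (leq_trans jl li).
Qed.

Lemma tail_gt0 (j : 'I_k.+1) : 0 < tail j.
Proof.
have [_ t0] := nd; rewrite tailS ltr_pwDl //.
by apply: sumr_ge0 => i _; exact: simplex_ge0.
Qed.

(** The covectors nonzero at [i] form an upper segment of the chain. If [x_j] is not among them, the
    level is at most [tail j.+1], which is smaller than [tail j] as the weights are positive. *)
Lemma tail_le_level (j : 'I_k.+1) i : (tail j <= level c i) = (covec x j i != phase0 R).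
Proof.
have [x0|x0] := eqVneq (covec x j i) (phase0 R) => /=.
  apply/negbTE; rewrite -ltNge; have [_ t0] := nd.
  apply: (@le_lt_trans _ _ (tail j.+1)); last by rewrite tailS ltrDr t0.
  rewrite /tail [leRHS]big_mkcond /= /level /c /=; apply: ler_sum => l _.
  case: leqP => jl.
    by case: (covec_le x i (jl : (l <= j)%N)) => ->; rewrite ?x0 eqxx mulr0.
  by case: (covec x l i == _); rewrite ?mulr1 ?mulr0 ?simplex_ge0 ?lexx.
rewrite /tail [leLHS]big_mkcond /= /level /c /=; apply: ler_sum => l _.
case: leqP => jl; last by rewrite mulr_ge0 ?ler0n ?simplex_ge0.
by rewrite (covec_support jl x0) x0 mulr1.
Qed.

Lemma level_first (j : 'I_k.+1) i : covec x j i != phase0 R ->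
  (forall l : 'I_k.+1, (l < j)%N -> covec x l i = phase0 R) -> level c i = tail j.
Proof.
move=> x0 lt0; rewrite /tail [RHS]big_mkcond /=; apply: eq_bigr => l _.
case: leqP => jl; first by rewrite (covec_support jl x0) x0 mulr1.
by rewrite lt0 // eqxx mulr0.
Qed.

(** Take a position where the support grows from [x_(j-1)] to [x_j], or for [j = 0] any position in
    the support of the first covector. *)
Lemma tail_attained (j : 'I_k.+1) : exists i, level c i = tail j.
Proof.
have [xn _] := nd.
have [j0|j0] := posnP j.
  have [i x0 _] := covec_perp x j 0 0.
  by exists i; apply: level_first => // l; rewrite j0.
have jk : (j.-1 < k.+1)%N by have := ltn_ord j; lia.
have neq : covec x (Ordinal jk) <> covec x j.
  by move=> e; apply: (xn (Ordinal jk) j); [rewrite /=; lia|exact: set_val_inj].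
have [i hi] : exists i, covec x (Ordinal jk) i <> covec x j i.
  by apply: contrapT => h; apply: neq; apply: funext => i; apply: contrapT => h';
    apply: h; exists i.
have pj : (Ordinal jk <= j)%N by rewrite /=; lia.
have x0 : covec x (Ordinal jk) i = phase0 R.
  by case: (covec_le x i pj) => // /hi.
exists i; apply: level_first.
  by apply/eqP => e; apply: hi; rewrite x0 e.
move=> l lj; have lp : (l <= Ordinal jk)%N by rewrite /=; lia.
by case: (covec_le x i lp) => // ->.
Qed.

Lemma level_attained i : level c i != 0 -> exists j : 'I_k.+1, level c i = tail j.
Proof.
move=> /level_neq0 u0.
case: (@arg_minnP _ ord_max (fun j : 'I_k.+1 => covec x j i != phase0 R)
  (fun j : 'I_k.+1 => j : nat) u0) => j x0 jmin.
exists j; apply: level_first => // l lj; apply/eqP; apply: contraTT lj => h.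
by rewrite -leqNgt jmin.
Qed.

Definition tails : seq R := [seq tail (val j) | j <- enum 'I_k.+1].

Lemma tails_sorted : sorted (fun a b : R => b < a) tails.
Proof.
rewrite /tails; rewrite map_comp val_enum_ord.
rewrite (@homo_sorted_in _ _ (mem (iota 0 k.+1)) _ ltn) //.
- move=> i j ik jk ij.
  have {}ik : (i < k.+1)%N by move: ik; rewrite inE mem_iota; lia.
  have {}jk : (j < k.+1)%N by move: jk; rewrite inE mem_iota; lia.
  exact: (@tail_lt (Ordinal ik) (Ordinal jk)).
- by apply/allP.
- exact: iota_ltn_sorted.
Qed.

Lemma mem_tails (a : R) : (a \in tails) <-> a != 0 /\ exists i, level c i = a.
Proof.
split.
  move=> /mapP[j _ ->]; split; first exact/lt0r_neq0/tail_gt0.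
  exact: tail_attained.
move=> [a0 [i la]]; move: a0; rewrite -la => /level_attained[j ->].
by apply: (map_f (fun j : 'I_k.+1 => tail (val j))); rewrite mem_enum.
Qed.

(** The [k + 1] tails are distinct, and each is one of the [n] levels. *)
Lemma nondegenerate_small : (k < n)%N.
Proof.
have -> : k.+1 = size tails by rewrite size_map size_enum_ord.
have sz : size [seq level c i | i <- enum 'I_n] = n by rewrite size_map size_enum_ord.
rewrite -[leqRHS]sz.
apply: uniq_leq_size.
  apply: (@sorted_uniq _ (fun a b : R => b < a)); last exact: tails_sorted.
    by move=> ? ? ? h1 h2; exact: lt_trans h2 h1.
  by move=> ?; exact: ltxx.
by move=> a /mem_tails[_ [i <-]]; apply: map_f; rewrite mem_enum.
Qed.

End Levels.

Lemma nondegenerate_inj k (x : chain Q k) (t : simplex R k) k' (x' : chain Q k')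
  (t' : simplex R k') : nondegenerate x t -> nondegenerate x' t' ->
  Fx (cell x t) = Fx (cell x' t') -> Fy (cell x t) = Fy (cell x' t') ->
  cell x t = cell x' t'.
Proof.
move=> nd nd' hx hy.
have lE i : level (cell x t) i = level (cell x' t') i.
  by rewrite !level_sqrt hx hy.
have tE : tails t = tails t'.
  apply: (@irr_sorted_eq _ (fun a b : R => b < a)).
  - by move=> ? ? ? h1 h2; exact: lt_trans h2 h1.
  - by move=> ?; exact: ltxx.
  - exact: tails_sorted nd.
  - exact: tails_sorted nd'.
  - move=> a; apply/idP/idP => /mem_tails; first move/(_ _ nd).
      by move=> [a0 [i la]]; apply/(mem_tails nd'); split => //; exists i; rewrite -lE.
    move/(_ _ nd').
    by move=> [a0 [i la]]; apply/(mem_tails nd); split => //; exists i; rewrite lE.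
have kE : k = k'.
  by have := congr1 size tE; rewrite /tails 2!size_map 2!size_enum_ord => -[].
subst k'.
have tlE (j : nat) : tail t j = tail t' j.
  (* Past the end both tails are empty sums. The value at [k + 1] is used when the last weight is
     recovered as a difference of tails. *)
  have [jk|jk] := ltnP j k.+1; last first.
    by rewrite /tail !big_pred0 // => l; apply/negbTE; rewrite -ltnNge (leq_trans _ jk).
  have := congr1 (fun s => nth 0 s j) tE.
  rewrite /tails /= (nth_map ord0) ?size_enum_ord // (nth_map ord0) ?size_enum_ord //.
  by rewrite nth_enum_ord.
have ttE : t = t'.
  apply: set_val_inj; apply/rowP => j.
  have := tailS t j; rewrite tlE (tailS t' j) tlE => /addIr.
  by rewrite ord1.
subst t'.
suff -> : x = x' by [].
apply: set_val_inj; apply: funext => j; apply: set_val_inj; apply: funext => i.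
change (covec x j i = covec x' j i).
have h := tail_le_level nd j i; have h' := tail_le_level nd' j i.
have [x0|x0] := eqVneq (covec x j i) (phase0 R).
  by move: h'; rewrite -lE h x0 eqxx /= => /esym/negbFE/eqP ->.
have x0' : covec x' j i != phase0 R by rewrite -h' -lE h.
rewrite (covec_last x) (covec_last x') x0 x0' /=.
have l0 : level (cell x t) i != 0.
  by apply: lt0r_neq0; apply: lt_le_trans (tail_gt0 nd j) _; rewrite h.
have [hX hY] := F_level x t i; have [hX' hY'] := F_level x' t i.
apply: (vxy_inj hv); apply: (mulfI l0).
  by rewrite -hX hx hX' -lE.
by rewrite -hY hy hY' -lE.
Qed.

Lemma F_injective a b : Fx a = Fx b -> Fy a = Fy b -> glued a b.
Proof.
case: a => k [x t]; case: b => k' [x' t'] hx hy.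
have [m [y [s [g nd]]]] := glued_nondegenerate x t.
have [m' [y' [s' [g' nd']]]] := glued_nondegenerate x' t'.
have [gx gy] := glued_F g; have [gx' gy'] := glued_F g'.
apply: (glued_trans (y := cell y s) g); rewrite glued_sym.
rewrite (nondegenerate_inj nd nd') //; first by rewrite -gx -gx'.
by rewrite -gy -gy'.
Qed.

Lemma compact_perp_complex : compact [set: order_complex R Q].
Proof.
apply: (@compact_order_complex _ _ _ n).
  exact: (compact_set_type (compact_perp hv)).
by move=> k x t; exact: nondegenerate_small.
Qed.

End Realization.

(** * Realizing a given point by a weighted chain *)

Section RealizationSurjective.
Context (R : realType) (m : nat) (v : 'I_m.+1 -> phase R).
Context (hv : forall i, circle (phase_val (v i))).
Context (zx zy : 'I_m.+1 -> R).
Context (z_le1 : forall i, zx i ^+ 2 + zy i ^+ 2 <= 1).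
Context (z_extremal : forall a b : R,
  exists2 i, zx i ^+ 2 + zy i ^+ 2 = 1 & a * zx i + b * zy i <= 0).

Local Notation Q := (set_type (perp v `\ (fun=> phase0 R))).

Let r i := Num.sqrt (zx i ^+ 2 + zy i ^+ 2).

Let r_ge0 i : 0 <= r i. Proof. exact: sqrtr_ge0. Qed.

Let r_sqr i : r i ^+ 2 = zx i ^+ 2 + zy i ^+ 2.
Proof. by rewrite sqr_sqrtr // addr_ge0 ?sqr_ge0. Qed.

Let r_le1 i : r i <= 1.
Proof. by rewrite -(@expr_le1 _ 2) // r_sqr. Qed.

(* The moduli in decreasing order; the default value 0 makes T m.+1 = 0. *)
Let s := sort (fun a b : R => b <= a) [seq r i | i <- enum 'I_m.+1].
Let T (j : nat) := nth 0 s j.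

Let size_s : size s = m.+1.
Proof. by rewrite size_sort size_map size_enum_ord. Qed.

Let T_ge0 j : 0 <= T j.
Proof.
have [js|js] := ltnP j (size s); last by rewrite /T nth_default.
have := mem_nth 0 js; rewrite mem_sort => /mapP[i _ h].
by rewrite /T h.
Qed.

Let T_anti j l : (j <= l)%N -> T l <= T j.
Proof.
move=> jl; have [ls|ls] := ltnP l (size s); last by rewrite {1}/T nth_default.
apply: (@sorted_leq_nth _ (fun a b : R => b <= a)) => //.
- by move=> ? ? ? h1 h2; exact: le_trans h2 h1.
- by apply: sort_sorted => a b; exact: le_total.
- by rewrite inE (leq_ltn_trans jl).
Qed.

Let T_attained i : exists2 l, (l < m.+1)%N & T l = r i.
Proof.
have : r i \in s by rewrite mem_sort; apply: map_f; rewrite mem_enum.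
by move=> /(nthP 0)[l ls e]; exists l => //; rewrite -size_s.
Qed.

Let T0 : T 0 = 1.
Proof.
apply/eqP; rewrite eq_le; apply/andP; split.
  have : (0 < size s)%N by rewrite size_s.
  by move=> /(mem_nth 0); rewrite mem_sort => /mapP[i _ h]; rewrite /T h.
(* The zero direction yields an entry of modulus 1. *)
have [i hi _] := z_extremal 0 0.
have [l _ hl] := T_attained i.
by rewrite -(sqrtr1 R) -hi -/(r i) -hl; exact: T_anti.
Qed.

Let Tlast : T m.+1 = 0.
Proof. by rewrite /T nth_default // size_s. Qed.

(** This turns the sum of weights into a telescoping one. It holds because [r i] is itself one of
    the sorted moduli: if it is below [T j], it is at most [T j.+1]. *)
Let step_min (j : nat) (i : 'I_m.+1) :
  (T j - T j.+1) * (T j <= r i)%R%:R = Num.min (T j) (r i) - Num.min (T j.+1) (r i).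
Proof.
have [Tr|rT] := leP (T j) (r i).
  by rewrite mulr1 min_l // (le_trans _ Tr) // T_anti.
rewrite mulr0 min_r; first by rewrite subrr.
have [l _ hl] := T_attained i.
have [lj|jl] := leqP l j; last by rewrite -hl T_anti.
by move: rT; rewrite -hl ltNge T_anti.
Qed.

Let sum_steps (i : 'I_m.+1) : \sum_(j < m.+1) (T j - T j.+1) * (T j <= r i)%R%:R = r i.
Proof.
under eq_bigr do rewrite step_min.
rewrite -(big_mkord xpredT (fun j => Num.min (T j) (r i) - Num.min (T j.+1) (r i))).
under eq_bigr do rewrite -opprB.
rewrite sumrN telescope_sumr // opprB T0 Tlast.
by rewrite min_r // min_l // subr0.
Qed.

(** The chain has one covector for each sorted modulus, repetitions included: equal neighbouring
    moduli give equal covectors and weight 0, so the distinct values need not be extracted. *)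
Lemma F_surjective : exists c : cells R Q, Fx c = zx /\ Fy c = zy.
Proof.
have [u hu] : exists u : 'I_m.+1 -> phase R, forall i, r i != 0 ->
    vx v u i = zx i / r i /\ vy v u i = zy i / r i.
  suff /choice[u hu] : forall i, exists p : phase R, r i != 0 ->
      px (phase_mul (v i) p) = zx i / r i /\ py (phase_mul (v i) p) = zy i / r i.
    by exists u.
  move=> i; have [_|ri] := eqVneq (r i) 0; first by exists (phase0 R).
  have [|p hp] := @exists_vxy R _ v hv i (zx i / r i) (zy i / r i); last by exists p.
  by rewrite !expr_div_n -mulrDl -r_sqr divff // expf_neq0.
have u0 i : r i != 0 -> u i != phase0 R.
  move=> ri; have [h1 h2] := hu i ri; apply/eqP => ui.
  have [h3 h4] := vxy0 v ui.
  have : r i ^+ 2 = 0.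
    rewrite r_sqr -[zx i](divfK ri) -[zy i](divfK ri) -h1 -h2 h3 h4; ring.
  by move/eqP; rewrite sqrf_eq0 (negbTE ri).
pose y (j : 'I_m.+1) : 'I_m.+1 -> phase R :=
  fun i => if (r i != 0) && (T j <= r i) then u i else phase0 R.
have yP j : y j \in perp v `\ (fun=> phase0 R).
  apply/mem_set/(perpP hv) => a b; have [i hi hab] := z_extremal a b.
  have r1 : r i = 1 by rewrite /r hi sqrtr1.
  have ri : r i != 0 by rewrite r1 oner_eq0.
  have yE : y j i = u i.
    by rewrite /y ri r1 /= ifT // -T0 T_anti.
  exists i; first by rewrite yE u0.
  by rewrite /vx /vy yE; have := hu i ri; rewrite /vx /vy r1 !divr1 => -[-> ->].
pose xq : 'I_m.+1 -> Q := fun j => exist _ (y j) (yP j).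
have xP : xq \in chain Q m.
  apply/mem_set => j l jl; rewrite leEsub; apply/lefP => i /=.
  rewrite /Order.le /= /phase_le phase_val_eq0 /y.
  have [/andP[ri Tj]|] := boolP ((r i != 0) && (T j <= r i)); last by rewrite eqxx.
  by rewrite ri (le_trans _ Tj) ?T_anti // eqxx orbT.
pose t0 : 'rV[R]_m.+1 := \row_j (T j - T j.+1).
have tP : t0 \in simplex R m.
  apply/mem_set; split => [j|]; first by rewrite mxE subr_ge0 T_anti.
  under eq_bigr do rewrite mxE.
  rewrite -(big_mkord xpredT (fun j => T j - T j.+1)).
  under eq_bigr do rewrite -opprB.
  by rewrite sumrN telescope_sumr // opprB T0 Tlast subr0.
exists (cell (exist _ xq xP : chain Q m) (exist _ t0 tP : simplex R m)).
have yE j i : vx v (y j) i = (T j <= r i)%R%:R * (zx i / r i) /\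
              vy v (y j) i = (T j <= r i)%R%:R * (zy i / r i).
  rewrite /vx /vy /y; have [r0|ri] /= := eqVneq (r i) 0.
    by rewrite px_mul py_mul px0 py0 r0 invr0; split; ring.
  case: (T j <= r i); first by rewrite !mul1r; exact: hu.
  by rewrite px_mul py_mul px0 py0; split; rewrite !mulr0 ?subr0 ?addr0 mul0r.
have zr i : r i * (zx i / r i) = zx i /\ r i * (zy i / r i) = zy i.
  have [r0|ri] := eqVneq (r i) 0; last by split; rewrite mulrC divfK.
  have := r_sqr i; rewrite r0 expr0n /= => /esym/eqP.
  by rewrite paddr_eq0 ?sqr_ge0 // !sqrf_eq0 => /andP[/eqP-> /eqP->]; split; ring.
split; apply: funext => i; rewrite /Fx /Fy /=.
  have [<- _] := zr i; rewrite -{1}sum_steps mulr_suml; apply: eq_bigr => j _.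
  rewrite /covec /= !set_valE /= mxE -mulrA; congr (_ * _).
  by have [<- _] := yE j i.
have [_ <-] := zr i; rewrite -{1}sum_steps mulr_suml; apply: eq_bigr => j _.
rewrite /covec /= !set_valE /= mxE -mulrA; congr (_ * _).
by have [_ <-] := yE j i.
Qed.

End RealizationSurjective.

(** * Smallest enclosing circles *)

Section EnclosingCircle.
Context (R : realType) (I : finType).
Implicit Types (zx zy wx wy : I -> R).

(* The points of the unit circle among the [z_i] lie in no open half-plane bounded *)
(* by a line through the origin. *)
Definition extremal zx zy := forall a b : R,
  exists2 i, zx i ^+ 2 + zy i ^+ 2 = 1 & a * zx i + b * zy i <= 0.

(** At an extremal index for the direction opposite to [(a, b)], the cross term in the squared
    modulus of the translated point is nonnegative. *)
Lemma enclosing_radius_ge zx zy zx' zy' (l a b : R) :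
  0 <= l -> (forall i, zx i ^+ 2 + zy i ^+ 2 <= 1) -> extremal zx' zy' ->
  (forall i, zx i = l * zx' i + a) -> (forall i, zy i = l * zy' i + b) ->
  l ^+ 2 + a ^+ 2 + b ^+ 2 <= 1.
Proof.
move=> l0 z1 e hx hy; have [i u h] := e (- a) (- b).
apply: le_trans (z1 i); rewrite hx hy.
have -> : (l * zx' i + a) ^+ 2 + (l * zy' i + b) ^+ 2 =
    l ^+ 2 * (zx' i ^+ 2 + zy' i ^+ 2) + a ^+ 2 + b ^+ 2 +
    2 * (l * (a * zx' i + b * zy' i)) by ring.
rewrite u mulr1 lerDl mulr_ge0 // mulr_ge0 //; lra.
Qed.

(** The radius bound for the similarity and for its inverse gives [l <= 1] and [l^-1 <= 1]; at
    [l = 1] it leaves no room for a translation. *)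
Lemma enclosing_circle_uniq zx zy zx' zy' (l a b : R) :
  0 < l -> (forall i, zx i ^+ 2 + zy i ^+ 2 <= 1) -> extremal zx zy ->
  (forall i, zx' i ^+ 2 + zy' i ^+ 2 <= 1) -> extremal zx' zy' ->
  (forall i, zx i = l * zx' i + a) -> (forall i, zy i = l * zy' i + b) ->
  zx = zx' /\ zy = zy'.
Proof.
move=> l0 z1 e z1' e' hx hy; have ln := lt0r_neq0 l0.
have h1 := enclosing_radius_ge (ltW l0) z1 e' hx hy.
have h2 : l^-1 ^+ 2 + (- a / l) ^+ 2 + (- b / l) ^+ 2 <= 1.
  apply: (enclosing_radius_ge _ z1' e); first by rewrite invr_ge0 ltW.
    by move=> i; rewrite hx; field.
  by move=> i; rewrite hy; field.
have a2 := sqr_ge0 a; have b2 := sqr_ge0 b.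
have a2' := sqr_ge0 (- a / l); have b2' := sqr_ge0 (- b / l).
have l1 : l <= 1 by rewrite -(@expr_le1 _ 2 l _ (ltW l0)) //; lra.
have li : 0 <= l^-1 by rewrite invr_ge0 ltW.
have l2 : l^-1 <= 1 by rewrite -(@expr_le1 _ 2 _ _ li) //; lra.
have {}l2 : 1 <= l by move: l2; rewrite invf_le1.
have lE : l = 1 by apply/eqP; rewrite eq_le l1.
have a0 : a = 0 by apply/eqP; rewrite -sqrf_eq0 eq_le a2 andbT; move: h1; rewrite lE expr1n => h1; lra.
have b0 : b = 0 by apply/eqP; rewrite -sqrf_eq0 eq_le b2 andbT; move: h1; rewrite lE expr1n => h1; lra.
by split; apply: funext => i; rewrite ?hx ?hy lE ?a0 ?b0 mul1r addr0.
Qed.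

Lemma bigmax_continuous (T : topologicalType) (f : I -> T -> R) :
  (forall i, continuous (f i)) -> continuous (fun x => \big[Num.max/0]_i f i x).
Proof.
move=> cf; elim: (index_enum I) => [|i s IH].
  rewrite (_ : (fun x => _) = fun=> 0); first exact: cst_continuous.
  by apply: funext => x; rewrite big_nil.
rewrite (_ : (fun x => _) = f i \max (fun x => \big[Num.max/0]_(i <- s) f i x)).
  by move=> x; apply: continuous_max; [exact: cf|exact: IH].
by apply: funext => x; rewrite big_cons.
Qed.

Definition sqdist wx wy (c : R * R) i : R := (wx i - c.1) ^+ 2 + (wy i - c.2) ^+ 2.

Definition sqradius wx wy (c : R * R) : R := \big[Num.max/0]_i sqdist wx wy c i.

Lemma sqradius_continuous wx wy : continuous (sqradius wx wy).
Proof.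
apply: bigmax_continuous => i; apply: sqr_sum_continuous => c.
  by apply: cvgB; [exact: cvg_cst|exact: cvg_fst].
by apply: cvgB; [exact: cvg_cst|exact: cvg_snd].
Qed.

Lemma exists_center wx wy (i0 : I) :
  exists c, forall c', sqradius wx wy c <= sqradius wx wy c'.
Proof.
pose w0 := (wx i0, wy i0).
(* Adding 1 ensures [B <= B ^+ 2]. A center outside the box of half-width [B] around [w0] has
   squared distance at least [B ^+ 2] to [w0], so it is worse than [w0] itself. *)
pose B := sqradius wx wy w0 + 1.
have B1 : 1 <= B by rewrite lerDr bigmax_ge_id.
pose A : set (R * R) := `[wx i0 - B, wx i0 + B] `*` `[wy i0 - B, wy i0 + B].
have w0A : A w0 by rewrite /A /=; split; rewrite in_itv /=; apply/andP; split; lra.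
have [||c cA hc] := @compact_EVT_min _ R (sqradius wx wy) A (ex_intro _ _ w0A).
- by apply: compact_setX; exact: segment_compact.
- exact/continuous_subspaceT/sqradius_continuous.
exists c => c'; have [c'A|c'A] := pselect (A c'); first exact: hc (mem_set c'A).
apply: (le_trans (hc _ (mem_set w0A))).
apply: (le_trans _ (le_bigmax _ _ i0)).
have B2 : B <= B ^+ 2 by rewrite expr2 ler_peMr // (le_trans _ B1).
have h : B <= sqdist wx wy c' i0.
  apply: (le_trans B2); rewrite leNgt; apply/negP => h; apply: c'A.
  have sx : (wx i0 - c'.1) ^+ 2 < B ^+ 2.
    by apply: le_lt_trans h; rewrite lerDl sqr_ge0.
  have sy : (wy i0 - c'.2) ^+ 2 < B ^+ 2.
    by apply: le_lt_trans h; rewrite lerDr sqr_ge0.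
  by split; rewrite /= in_itv /=; apply/andP; split; nra.
by apply: le_trans h; rewrite lerDl.
Qed.

(* Otherwise moving the center slightly towards (a, b) shrinks the radius. *)
Lemma center_extremal wx wy c : (forall c', sqradius wx wy c <= sqradius wx wy c') ->
  0 < sqradius wx wy c -> forall a b : R,
  exists2 i, sqdist wx wy c i = sqradius wx wy c &
    a * (wx i - c.1) + b * (wy i - c.2) <= 0.
Proof.
move=> hc r0 a b; apply: contrapT => hn.
set r := sqradius wx wy c in hc r0 hn.
pose N := a ^+ 2 + b ^+ 2.
have N0 : 0 <= N by rewrite addr_ge0 ?sqr_ge0.
have N1 : 0 < N + 1 by rewrite ltr_wpDl.
pose p i := a * (wx i - c.1) + b * (wy i - c.2).
have moved (e : R) i : sqdist wx wy (c.1 + e * a, c.2 + e * b) i =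
    sqdist wx wy c i - 2 * e * p i + e ^+ 2 * N.
  by rewrite /sqdist /p /N /=; ring.
have : \forall e \near (0 : R)^'+, forall i : I,
    sqdist wx wy (c.1 + e * a, c.2 + e * b) i < r.
  apply: filter_forall => i.
  (* Points on the circle come closer at first order, since [p i] is positive for them; the others
     have a gap to [r] that a small move does not close. *)
  have [ir|ir] := eqVneq (sqdist wx wy c i) r.
    have p0 : 0 < p i.
      by rewrite ltNge; apply/negP => h; apply: hn; exists i.
    near=> e.
    have e0 : 0 < e by near: e; exact: nbhs_right_gt.
    have eN : e < p i / (N + 1).
      by near: e; apply: nbhs_right_lt; rewrite divr_gt0.
    rewrite moved ir; move: eN; rewrite ltr_pdivlMr // => eN.
    by nra.
  have g0 : 0 < r - sqdist wx wy c i.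
    by rewrite subr_gt0 lt_neqAle ir le_bigmax.
  have D0 : 0 < N + 2 * `|p i| + 1 by have := normr_ge0 (p i); lra.
  near=> e.
  have e0 : 0 < e by near: e; exact: nbhs_right_gt.
  have e1 : e < 1 by near: e; exact: nbhs_right_lt.
  have eN : e < (r - sqdist wx wy c i) / (N + 2 * `|p i| + 1).
    by near: e; apply: nbhs_right_lt; rewrite divr_gt0.
  rewrite moved; move: eN; rewrite ltr_pdivlMr // => eN.
  have pn : - p i <= `|p i| by rewrite -normrN ler_norm.
  have h1 : e ^+ 2 * N <= e * N by rewrite ler_wpM2r // expr2 ler_piMr // ltW.
  have h2 : - (2 * e * p i) <= e * (2 * `|p i|).
    have -> : - (2 * e * p i) = e * (2 * - p i) by ring.
    by apply: ler_wpM2l; [exact: ltW|exact: ler_wpM2l].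
  by nra.
move=> /(@filter_ex _ _ _) [e he].
have := hc (c.1 + e * a, c.2 + e * b); rewrite leNgt => /negP; apply.
by apply/bigmax_ltP; split => // i _; exact: he.
Unshelve. all: by end_near. Qed.

Lemma exists_enclosing_circle wx wy (i0 i1 : I) : (wx i0 <> wx i1 \/ wy i0 <> wy i1) ->
  exists (zx zy : I -> R) (l a b : R), [/\ 0 < l,
    forall i, zx i ^+ 2 + zy i ^+ 2 <= 1, extremal zx zy,
    forall i, wx i = l * zx i + a & forall i, wy i = l * zy i + b].
Proof.
move=> w01; have [c hc] := exists_center wx wy i0.
set r := sqradius wx wy c in hc.
have r0 : 0 < r.
  rewrite lt_neqAle bigmax_ge_id andbT eq_sym; apply/eqP => r0.
  have eqc i : wx i = c.1 /\ wy i = c.2.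
    have : sqdist wx wy c i <= 0 by rewrite -r0 le_bigmax.
    have := sqr_ge0 (wx i - c.1); have := sqr_ge0 (wy i - c.2); rewrite /sqdist.
    move=> h1 h2 h3; split; apply/eqP; rewrite -subr_eq0 -sqrf_eq0 eq_le sqr_ge0 andbT.
      lra.
    lra.
  by have [h1 h2] := eqc i0; have [h3 h4] := eqc i1; case: w01; rewrite ?h1 ?h2 ?h3 ?h4.
pose l := Num.sqrt r.
have l0 : 0 < l by rewrite sqrtr_gt0.
have ln := lt0r_neq0 l0.
have l2 : l ^+ 2 = r by rewrite sqr_sqrtr // ltW.
exists (fun i => (wx i - c.1) / l), (fun i => (wy i - c.2) / l), l, c.1, c.2.
have sq i : ((wx i - c.1) / l) ^+ 2 + ((wy i - c.2) / l) ^+ 2 = sqdist wx wy c i / r.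
  by rewrite !expr_div_n -mulrDl l2.
split => // [i|a b|i|i].
- by rewrite sq ler_pdivrMr // mul1r le_bigmax.
- have [i hi hab] := center_extremal hc r0 a b; exists i.
    by rewrite sq hi divff // lt0r_neq0.
  by rewrite !mulrA -mulrDl pmulr_lle0 // invr_gt0.
- by field.
- by field.
Qed.

End EnclosingCircle.

(** * The homeomorphism *)

Lemma continuous_set_type (S T : topologicalType) (A : set T) (f : S -> A) :
  continuous (fun x => set_val (f x)) -> continuous f.
Proof.
move=> /continuousP cf; apply/continuousP => U [V oV VU].
by rewrite -VU; exact: cf.
Qed.

(** * Scaling to the unit sphere *)

Section Normalization.
Context (R : realType) (d : nat).
Implicit Type u : 'rV[R]_d.+1.

Definition euclidean u : R := Num.sqrt (\sum_j u ord0 j ^+ 2).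

Lemma sum_sqr_ge0 u : 0 <= \sum_j u ord0 j ^+ 2.
Proof. by apply: sumr_ge0 => j _; exact: sqr_ge0. Qed.

Lemma sum_sqr_eq0 u : (\sum_j u ord0 j ^+ 2 == 0) = (u == 0).
Proof.
rewrite psumr_eq0 => [|j _]; last exact: sqr_ge0.
apply/allP/eqP => [h|-> j _]; last by rewrite mxE expr0n eqxx.
apply/rowP => j; rewrite mxE; apply/eqP; rewrite -sqrf_eq0.
exact: (h j (mem_index_enum j)).
Qed.

Lemma euclidean_gt0 u : u != 0 -> 0 < euclidean u.
Proof. by move=> u0; rewrite sqrtr_gt0 lt_neqAle sum_sqr_ge0 andbT eq_sym sum_sqr_eq0. Qed.

Lemma euclidean_scale u (l : R) : 0 <= l -> euclidean (l *: u) = l * euclidean u.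
Proof.
move=> l0; rewrite /euclidean.
under eq_bigr do rewrite mxE exprMn.
by rewrite -mulr_sumr sqrtrM ?sqr_ge0 // sqrtr_sqr ger0_norm.
Qed.

Lemma normalize_sphere u : u != 0 -> (euclidean u)^-1 *: u \in sphere R d.
Proof.
move=> u0; apply/mem_set; rewrite /sphere /=.
under eq_bigr do rewrite mxE exprMn.
rewrite -mulr_sumr -[X in _ * X](sqr_sqrtr (sum_sqr_ge0 u)) -exprMn mulVf ?expr1n //.
exact/lt0r_neq0/euclidean_gt0.
Qed.

End Normalization.

(** * The map to the sphere and its bijectivity *)

Section MainMap.
Context (R : realType) (m d : nat) (v : 'I_m.+2 -> phase R).
Context (hv : forall i, circle (phase_val (v i))).
Context (dE : d.+1 = m.+1.*2).

Local Notation Q := (set_type (perp v `\ (fun=> phase0 R))).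

(* Coordinates on C^n modulo translations: [z_i - z_last], as pairs of reals. *)
Definition reduced (zx zy : 'I_m.+2 -> R) : 'rV[R]_d.+1 :=
  \row_j (if odd j then zy (inord j./2) - zy ord_max else zx (inord j./2) - zx ord_max).

Lemma reduced_coord zx zy zx' zy' (l : R) :
  reduced zx zy = l *: reduced zx' zy' -> forall i,
  zx i - zx ord_max = l * (zx' i - zx' ord_max) /\
  zy i - zy ord_max = l * (zy' i - zy' ord_max).
Proof.
move=> h i; have [->|im] := eqVneq i ord_max; first by rewrite !subrr mulr0.
have im1 : (i < m.+1)%N.
  by have := ltn_ord i; rewrite ltnS leq_eqVlt => /orP[/eqP e|//]; case/eqP: im; apply: val_inj.
have i0 : (i.*2 < d.+1)%N by rewrite dE ltn_double.
have i1 : (i.*2.+1 < d.+1)%N by rewrite dE; lia.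
split.
  have := congr1 (fun u : 'rV[R]_d.+1 => u ord0 (Ordinal i0)) h.
  by rewrite !mxE /= odd_double doubleK inord_val.
have := congr1 (fun u : 'rV[R]_d.+1 => u ord0 (Ordinal i1)) h.
by rewrite !mxE /= odd_double /= uphalf_double inord_val.
Qed.

Lemma reduced_affine zx zy wx wy (l a b : R) :
  (forall i, wx i = l * zx i + a) -> (forall i, wy i = l * zy i + b) ->
  reduced wx wy = l *: reduced zx zy.
Proof.
move=> hx hy; apply/rowP => j; rewrite !mxE !hx !hy.
by case: ifP => _; ring.
Qed.

Lemma reduced_surjective (u : 'rV[R]_d.+1) : exists wx wy, reduced wx wy = u.
Proof.
(* The representative of the translation class whose last entry is 0. *)
exists (fun i => if i == ord_max then 0 else u ord0 (inord i.*2)),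
  (fun i => if i == ord_max then 0 else u ord0 (inord i.*2.+1)).
apply/rowP => j; rewrite mxE eqxx !subr0.
have jm : (j./2 < m.+1)%N by rewrite ltn_half_double -dE.
have e : (inord j./2 : 'I_m.+2) = j./2 :> nat by rewrite inordK // ltnW.
have -> : (inord j./2 == ord_max :> 'I_m.+2) = false.
  by apply/negbTE; rewrite -val_eqE /= e neq_ltn jm.
have jE := odd_double_half j.
by case: ifP jE => oj jE; rewrite e; congr (u _ _); apply: val_inj;
  rewrite /= inordK //; move: (ltn_ord j); rewrite -?dE; lia.
Qed.

(** A constant tuple is not extremal: in the direction of its common value the condition would read
    [1 <= 0]. *)
Lemma reduced_neq0 zx zy : extremal zx zy -> reduced zx zy != 0.
Proof.
move=> e; apply/eqP => h.
have h' : reduced zx zy = 0 *: reduced zx zy by rewrite scale0r.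
have c := reduced_coord h'.
have [i u] := e (zx ord_max) (zy ord_max).
have [/eqP + /eqP] := c i; rewrite !mul0r !subr_eq0 => /eqP hx /eqP hy.
by move: u; rewrite hx hy -!expr2 => ->; rewrite ler10.
Qed.

Lemma cell_extremal (c : cells R Q) : extremal (Fx c) (Fy c).
Proof. by case: c => k [x t] a b; exact: F_image. Qed.

Lemma cell_le1 (c : cells R Q) i : Fx c i ^+ 2 + Fy c i ^+ 2 <= 1.
Proof. by case: c => k [x t]; exact: F_le1. Qed.

Definition to_sphere (c : cells R Q) : sphere R d :=
  exist _ ((euclidean (reduced (Fx c) (Fy c)))^-1 *: reduced (Fx c) (Fy c))
    (normalize_sphere (reduced_neq0 (cell_extremal c))).

Lemma to_sphereE c : set_val (to_sphere c) =
  (euclidean (reduced (Fx c) (Fy c)))^-1 *: reduced (Fx c) (Fy c).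
Proof. by []. Qed.

Lemma reduced_continuous : continuous (fun c : cells R Q => reduced (Fx c) (Fy c)).
Proof.
apply: row_continuous => j.
have -> : (fun c : cells R Q => reduced (Fx c) (Fy c) ord0 j) =
    if odd j then (fun c => Fy c (inord j./2) - Fy c ord_max)
    else (fun c => Fx c (inord j./2) - Fx c ord_max).
  by apply: funext => c; rewrite mxE; case: ifP.
case: ifP => _ c; apply: cvgB.
- exact: Fy_continuous.
- exact: Fy_continuous.
- exact: Fx_continuous.
- exact: Fx_continuous.
Qed.

Lemma to_sphere_continuous : continuous to_sphere.
Proof.
apply: continuous_set_type.
pose G (c : cells R Q) := reduced (Fx c) (Fy c).
have cG j : continuous (fun c => G c ord0 j).
  move=> c; apply: (@continuous_comp _ _ _ G (fun M : 'rV[R]_d.+1 => M ord0 j)).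
    exact: reduced_continuous.
  exact: coord_continuous.
have cN : continuous (fun c => euclidean (G c)).
  move=> c; apply: (@continuous_comp _ _ _ (fun c => \sum_j G c ord0 j ^+ 2) Num.sqrt).
    apply: sum_continuous => j c'.
    apply: (@continuous_comp _ _ _ (fun c => G c ord0 j) (fun t : R => t ^+ 2)).
      exact: cG.
    exact: exprn_continuous.
  exact: sqrt_continuous.
apply: row_continuous => j.
have -> : (fun c => set_val (to_sphere c) ord0 j) =
    (fun c => (euclidean (G c))^-1 * G c ord0 j).
  by apply: funext => c; rewrite to_sphereE mxE.
move=> c; apply: cvgM; last exact: cG.
apply: cvgV; last exact: cN.
exact/lt0r_neq0/euclidean_gt0/reduced_neq0/cell_extremal.
Qed.

Lemma to_sphere_glued a b : glued a b -> to_sphere a = to_sphere b.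
Proof.
by move=> /glued_F[hx hy]; apply: set_val_inj; rewrite !to_sphereE hx hy.
Qed.

Lemma to_sphere_inj a b : to_sphere a = to_sphere b -> glued a b.
Proof.
move=> /(congr1 set_val); rewrite !to_sphereE.
set A := reduced _ _; set B := reduced (Fx b) _ => h.
have A0 : 0 < euclidean A by exact/euclidean_gt0/reduced_neq0/cell_extremal.
have B0 : 0 < euclidean B by exact/euclidean_gt0/reduced_neq0/cell_extremal.
pose l := euclidean A / euclidean B.
have l0 : 0 < l by rewrite divr_gt0.
have AB : A = l *: B.
  by rewrite /l -scalerA -h scalerA divff ?scale1r // lt0r_neq0.
have c := reduced_coord AB.
have [hx hy] : Fx a = Fx b /\ Fy a = Fy b.
  (* Equal normalizations mean equality up to a scaling by [l] and a translation, which is read off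
     at the last entry. *)
  apply: (@enclosing_circle_uniq _ _ _ _ _ _ l
    (Fx a ord_max - l * Fx b ord_max) (Fy a ord_max - l * Fy b ord_max)) => //;
    try exact: cell_le1; try exact: cell_extremal.
    by move=> i; have [+ _] := c i; lra.
  by move=> i; have [_ +] := c i; lra.
exact: F_injective.
Qed.

Lemma to_sphere_surj y : exists c, to_sphere c = y.
Proof.
have yS : \sum_i (set_val y) ord0 i ^+ 2 = 1 by exact: (set_valP y).
have [wx [wy wE]] := reduced_surjective (set_val y).
have [i hi] : exists i, wx i <> wx ord_max \/ wy i <> wy ord_max.
  apply: contrapT => hn.
  have c i : wx i = wx ord_max /\ wy i = wy ord_max.
    by split; apply: contrapT => h; apply: hn; exists i; [left|right].
  have y0 : set_val y = 0.
    rewrite -wE; apply/rowP => j; rewrite !mxE.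
    have [-> ->] := c (inord j./2).
    by rewrite !subrr if_same.
  move/eqP: yS; rewrite y0 big1 => [|j _]; first by rewrite eq_sym oner_eq0.
  by rewrite mxE expr0n.
have [zx [zy [l [a [b [l0 z1 e hx hy]]]]]] := exists_enclosing_circle hi.
have [c [cx cy]] := F_surjective hv z1 e.
exists c; apply: set_val_inj; rewrite to_sphereE cx cy.
have ln := lt0r_neq0 l0.
have zE : reduced zx zy = l^-1 *: set_val y.
  by rewrite -wE (reduced_affine hx hy) scalerA mulVf // scale1r.
have y1 : euclidean (set_val y) = 1 by rewrite /euclidean yS sqrtr1.
rewrite zE euclidean_scale ?invr_ge0 ?ltW // y1 mulr1 invrK scalerA mulfV //.
by rewrite scale1r.
Qed.

Lemma perp_homeomorphic_sphere : homeomorphic (order_complex R Q) (sphere R d).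
Proof.
(* Although [repr] is an arbitrary choice, [f] is continuous because [to_sphere] is constant on
   gluing classes. *)
pose f (q : order_complex R Q) : sphere R d := to_sphere (repr q).
apply: (@compact_bij_homeomorphic _ _ f).
- exact: compact_perp_complex.
- exact/set_type_hausdorff/norm_hausdorff.
- apply: repr_comp_continuous; first exact: to_sphere_continuous.
  move=> a b /eqP/eqmodP ab; apply/eqP/to_sphere_glued; exact: ab.
- move=> p q /= /to_sphere_inj pq; rewrite -[p]reprK -[q]reprK.
  by apply/eqmodP; exact: pq.
- move=> y; have [c <-] := to_sphere_surj y.
  exists (\pi_(order_complex R Q) c)%qT => /=; apply: to_sphere_glued.
  have : (repr (\pi_(order_complex R Q) c) = c %[mod order_complex R Q])%qT by rewrite reprK.
  by move=> /eqmodP.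
Qed.

End MainMap.

Theorem theorem1p2 (R : realType) (n : nat) (hn : (2 <= n)%N)
    (v : 'I_n -> phase R) (hv : forall i, circle (phase_val (v i))) :
  homeomorphic
    (order_complex R (set_type (perp v `\ (fun=> phase0 R))))
    (set_type (sphere R (2 * n - 3))).
Proof.
case: n hn v hv => [|[|m]] // _ v hv.
(* With [n = m + 2], the dimension [2 * n - 3] plus 1 is [2 * (m + 1)], the real dimension of C^n
   modulo translations. *)
by apply: perp_homeomorphic_sphere => //; lia.
Qed.
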